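(* Let $(f_n)$ be a regular polynomial sequence with $\deg f_n=d_n$ such that $J_{(f_n)}\subset\mathbb{R}$. Then $$R_{(f_n)}(z)=\lim_{k\to\infty}\frac{R_{(f_n)}(F_k(z))\,F_k'(z)}{d_1\cdots d_k},$$ where the limit exists locally uniformly in $\mathbb{C}\setminus J_{(f_n)}$.
   Context: A sequence of complex polynomials $f_n(z)=\sum_{j=0}^{d_n}a_{n,j}z^j$ with $d_n\ge2$, $a_{n,d_n}\ne0$ for all $n\in\mathbb{N}$ is called a regular polynomial sequence, written $(f_n)\in\mathcal{R}$, if there are positive real numbers $A_1,A_2,A_3$ such that for all $n\in\mathbb{N}$: $|a_{n,d_n}|\ge A_1$; $|a_{n,j}|\le A_2|a_{n,d_n}|$ for $j=0,1,\ldots,d_n-1$; and $\log|a_{n,d_n}|\le A_3 d_n$. Put $F_0(z)=z$ and $F_n=f_n\circ F_{n-1}$, so $F_n=f_n\circ\cdots\circ f_1$. The Fatou set of $(f_n)$ is the set of points of $\overline{\mathbb{C}}$ at which (i.e. on some neighbourhood of which) the sequence $(F_n)_{n\ge1}$ is normal in the sense of Montel, and the Julia set $J_{(f_n)}$ is its complement in $\overline{\mathbb{C}}$. For $(f_n)\in\mathcal{R}$, $J_{(f_n)}$ is a compact non-polar subset of $\mathbb{C}$; $\mu_{J_{(f_n)}}$ denotes its equilibrium measure. When $J_{(f_n)}\subset\mathbb{R}$, the resolvent function is $$R_{(f_n)}(z):=\int\frac{d\mu_{J_{(f_n)}}(x)}{x-z},\qquad z\in\mathbb{C}\setminus J_{(f_n)}.$$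 In this situation $F_k\to\infty$ locally uniformly on $\mathbb{C}\setminus J_{(f_n)}$, so on each compact subset of $\mathbb{C}\setminus J_{(f_n)}$ the expression under the limit is defined for all sufficiently large $k$. *)

(* Defs.v *)
From HB Require Import structures.
From mathcomp Require Import all_boot all_order all_algebra.
From mathcomp Require Import all_classical all_reals all_analysis.
From mathcomp Require Export complex.

Set Implicit Arguments.
Unset Strict Implicit.
Unset Printing Implicit Defensive.

Import Order.TTheory GRing.Theory Num.Theory.
Import numFieldTopology.Exports numFieldNormedType.Exports.

Local Open Scope classical_set_scope.
Local Open Scope complex_scope.
Local Open Scope ring_scope.

(* R[i] with the topology and uniformity of its modulus. *)
HB.instance Definition _ (R : realType) := NormedModule.copy R[i] R[i]^o.

Definition cmod (R : realType) (z : R[i]) : R := ComplexField.Normc.normc z.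

Definition deg (R : realType) (p : {poly R[i]}) : nat := (size p).-1.

(* Sequences are indexed by the positive integers; the value f 0 is unused. *)
Definition regular_polynomial_sequence (R : realType) (f : nat -> {poly R[i]})
    : Prop :=
  (forall n, (0 < n)%N -> (2 <= deg (f n))%N) /\
  exists A1 A2 A3 : R,
    [/\ 0 < A1, 0 < A2, 0 < A3 &
     forall n, (0 < n)%N ->
       [/\ A1 <= cmod (lead_coef (f n)),
           forall j, (j < deg (f n))%N ->
             cmod (f n)`_j <= A2 * cmod (lead_coef (f n)) &
           ln (cmod (lead_coef (f n))) <= A3 * (deg (f n))%:R]].

Fixpoint Fcomp (R : realType) (f : nat -> {poly R[i]}) (n : nat) : {poly R[i]} :=
  if n is m.+1 then f m.+1 \Po Fcomp f m else 'X.

(* None is the point at infinity. *)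
Notation sphere R := (one_point_compactification R[i]).

Definition chordal (R : realType) (p q : sphere R) : R :=
  match p, q with
  | Some z, Some w => 2 * cmod (z - w) /
      (Num.sqrt (1 + cmod z ^+ 2) * Num.sqrt (1 + cmod w ^+ 2))
  | Some z, None | None, Some z => 2 / Num.sqrt (1 + cmod z ^+ 2)
  | None, None => 0
  end.

(* Extension of a nonconstant polynomial to the sphere, fixing infinity. *)
Definition sphere_map (R : realType) (p : {poly R[i]}) : sphere R -> sphere R :=
  omap (horner p).

Definition locally_uniformly_cvg (R : realType) (U : set (sphere R))
    (h : nat -> sphere R -> sphere R) (g : sphere R -> sphere R) : Prop :=
  forall K : set (sphere R), compact K -> K `<=` U ->
  forall e : R, 0 < e ->
    \forall k \near \oo, forall p, K p -> chordal (h k p) (g p) < e.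

(* Every sequence of members h (s 0), h (s 1), ... of the family has a
   subsequence converging locally uniformly on U in the spherical metric; the
   constant limit infinity is allowed. *)
Definition montel_normal (R : realType) (U : set (sphere R))
    (h : nat -> sphere R -> sphere R) : Prop :=
  forall s : nat -> nat, exists2 t : nat -> nat,
    {homo t : m n / (m < n)%N} &
    exists g, locally_uniformly_cvg U (fun k => h (s (t k))) g.

Definition fatou_set (R : realType) (f : nat -> {poly R[i]}) : set (sphere R) :=
  [set p | exists U : set (sphere R),
     [/\ open U, U p & montel_normal U (fun n => sphere_map (Fcomp f n.+1))]].

Definition julia_set (R : realType) (f : nat -> {poly R[i]}) : set (sphere R) :=
  ~` fatou_set f.

Definition planar_part (R : realType) (A : set (sphere R)) : set R[i] :=
  [set z | A (Some z)].

Definition sphere_real_line (R : realType) : set (sphere R) :=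
  [set Some x%:C | x in [set: R]].

Definition borelC (R : realType) :=
  g_sigma_algebraType [set A : set R[i] | open A].

(* The double integral of log (1 / |z - w|), with value +oo on the diagonal. *)
Definition log_energy (R : realType) (mu : probability (borelC R) R) : \bar R :=
  (\int[mu]_z \int[mu]_w (- lne (cmod ((z : R[i]) - (w : R[i])))%:E))%E.

Definition is_equilibrium_measure (R : realType) (K : set R[i])
    (mu : probability (borelC R) R) : Prop :=
  mu K = 1%E /\
  forall nu : probability (borelC R) R, nu K = 1%E ->
    (log_energy mu <= log_energy nu)%E.

Definition complex_integral (R : realType) (mu : probability (borelC R) R)
    (g : R[i] -> R[i]) : R[i] :=
  Rintegral mu [set: borelC R] (fun x => complex.Re (g x)) +i*
  Rintegral mu [set: borelC R] (fun x => complex.Im (g x)).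

Definition resolvent (R : realType) (mu : probability (borelC R) R)
    (z : R[i]) : R[i] :=
  complex_integral mu (fun x => (x - z)^-1).

(* Main.v *)
(* Since the Julia set J is real, vertical rays show that every nonreal point
   escapes; hence J is the set of points with bounded orbit, and F_k tends to
   infinity locally uniformly off J.  Fix z0 in J.  The roots of F_k - F_k(z0) lie
   in J, and the average of - log |z - x| over these roots x is
   c_k - log |F_k(z) - F_k(z0)| / (d_1...d_k), where c_k = log |lead F_k| / (d_1...d_k)
   is a Cauchy sequence.  Just above J the last term is small and, for k large,
   nonnegative.  A limit of the root measures therefore has energy at most lim c_k,
   so the equilibrium measure mu does too, while the mixed energy of mu and the
   k-th root measure is at least c_k - o(1): the energy of their difference,
   regularised by a small vertical shift, tends to 0.  The logarithmic kernel
   is positive definite on neutral measures on a line, and its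
   energy dominates the squared resolvent at nonreal points, so the resolvents S_k
   of the root measures converge to that of mu.  Finally
   F_k' / (d_1...d_k) = - (F_k - F_k(z0)) S_k and w R(w) -> -1 as w -> oo. *)

Require Import Defs.
From HB Require Import structures.
From mathcomp Require Import all_boot all_order all_algebra.
From mathcomp Require Import all_classical all_reals all_analysis.
From mathcomp Require Import complex.
From mathcomp Require Import ring lra measurable_realfun.

Set Implicit Arguments.
Unset Strict Implicit.
Unset Printing Implicit Defensive.

Import Order.TTheory GRing.Theory Num.Theory.
Import numFieldTopology.Exports numFieldNormedType.Exports.

Local Open Scope classical_set_scope.
Local Open Scope complex_scope.
Local Open Scope ring_scope.

(** * The modulus and polynomials on the complex plane *)

(** The root measures consist of atoms, so their own logarithmic energy is infinite. The kernel is
    therefore replaced by [logk e], that is [- log |x - y + ie|], which is continuous and still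
    positive definite on neutral measures; the corresponding potential of the roots is read off from
    [F_k] at [x + ie]. There [F_k] must be large, to make the logarithm nonnegative, while its
    logarithm must stay below a small multiple of [d_1...d_k]. Both hold at a fixed small height [e]
    once [k] is large, so [e] is always chosen before [k]. Because [J] lies on a line, the root
    measures have monotone quantile functions, and the competitor in the minimality of [mu] is built
    from a limit of these. Energies control resolvents only at nonreal points. Real points off [J]
    are reached by a small vertical step, which is cheap because all the resolvents are Lipschitz
    with a common constant at a fixed distance from [J]. *)

Lemma cmodE (R : realType) (z : R[i]) :
  cmod z = Num.sqrt (complex.Re z ^+ 2 + complex.Im z ^+ 2).
Proof. by case: z. Qed.

Lemma norm_cmod (R : realType) (z : R[i]) : `|z| = (cmod z)%:C.
Proof. by rewrite normc_def cmodE. Qed.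

Lemma sqr_cmod (R : realType) (z : R[i]) :
  cmod z ^+ 2 = complex.Re z ^+ 2 + complex.Im z ^+ 2.
Proof. by rewrite cmodE sqr_sqrtr// addr_ge0// sqr_ge0. Qed.

Lemma cmod_ge0 (R : realType) (z : R[i]) : 0 <= cmod z.
Proof. by rewrite cmodE sqrtr_ge0. Qed.

Lemma cmod0 (R : realType) : cmod (0 : R[i]) = 0.
Proof. by rewrite cmodE /= expr0n addr0 sqrtr0. Qed.

Lemma cmod_eq0 (R : realType) (z : R[i]) : (cmod z == 0) = (z == 0).
Proof.
apply/eqP/eqP => [|->]; last exact: cmod0.
exact: ComplexField.Normc.eq0_normc.
Qed.

Lemma cmod_gt0 (R : realType) (z : R[i]) : (0 < cmod z) = (z != 0).
Proof. by rewrite lt_def cmod_ge0 andbT cmod_eq0. Qed.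

Lemma cmod_real (R : realType) (x : R) : cmod x%:C = `|x|.
Proof. by rewrite cmodE /= expr0n addr0 sqrtr_sqr. Qed.

Lemma cmod1 (R : realType) : cmod (1 : R[i]) = 1.
Proof. by rewrite [LHS]cmod_real normr1. Qed.

Lemma cmodM (R : realType) (z w : R[i]) : cmod (z * w) = cmod z * cmod w.
Proof. exact: ComplexField.Normc.normcM. Qed.

Lemma cmodV (R : realType) (z : R[i]) : cmod z^-1 = (cmod z)^-1.
Proof. exact: ComplexField.Normc.normcV. Qed.

Lemma cmodX (R : realType) (z : R[i]) n : cmod (z ^+ n) = cmod z ^+ n.
Proof. by elim: n => [|n IH]; rewrite ?expr0 ?cmod1// !exprS cmodM IH. Qed.

Lemma cmodN (R : realType) (z : R[i]) : cmod (- z) = cmod z.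
Proof. by rewrite !cmodE; case: z => a b /=; rewrite !sqrrN. Qed.

Lemma cmodB (R : realType) (z w : R[i]) : cmod (z - w) = cmod (w - z).
Proof. by rewrite -cmodN opprB. Qed.

Lemma cmod_conj (R : realType) (z : R[i]) : cmod z^*%C = cmod z.
Proof. by rewrite !cmodE; case: z => a b /=; rewrite !sqrrN. Qed.

Lemma cmod_nat (R : realType) n : cmod (n%:R : R[i]) = n%:R.
Proof. by rewrite -(rmorph_nat (real_complex R)) cmod_real normr_nat. Qed.

Lemma cmodD (R : realType) (z w : R[i]) : cmod (z + w) <= cmod z + cmod w.
Proof. by have := ler_normD z w; rewrite !norm_cmod -rmorphD lecR. Qed.

Lemma cmodD_ge (R : realType) (z w : R[i]) : cmod z - cmod w <= cmod (z + w).
Proof.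
rewrite lerBlDr; have := cmodD (z + w) (- w).
by rewrite addrK cmodN.
Qed.

Lemma cmod_sum (R : realType) I (s : seq I) (P : pred I) (F : I -> R[i]) :
  cmod (\sum_(i <- s | P i) F i) <= \sum_(i <- s | P i) cmod (F i).
Proof.
elim/big_ind2: _ => [|x y z w h1 h2|//]; first by rewrite cmod0.
by rewrite (le_trans (cmodD _ _))// lerD.
Qed.

Lemma Re_le_cmod (R : realType) (z : R[i]) : `|complex.Re z| <= cmod z.
Proof. by rewrite cmodE -sqrtr_sqr ler_wsqrtr// lerDl sqr_ge0. Qed.

Lemma Im_le_cmod (R : realType) (z : R[i]) : `|complex.Im z| <= cmod z.
Proof. by rewrite cmodE -sqrtr_sqr ler_wsqrtr// lerDr sqr_ge0. Qed.

Lemma cmod_le_ReIm (R : realType) (z : R[i]) :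
  cmod z <= `|complex.Re z| + `|complex.Im z|.
Proof.
rewrite {1}(complexE z) (le_trans (cmodD _ _))// cmodM cmod_real lerD2l.
by rewrite cmod_real cmodE/= expr0n add0r expr1n sqrtr1 mul1r.
Qed.

Lemma ReD (R : realType) (z w : R[i]) :
  complex.Re (z + w) = complex.Re z + complex.Re w.
Proof. by case: z w => [a b] [c d]. Qed.

Lemma ImD (R : realType) (z w : R[i]) :
  complex.Im (z + w) = complex.Im z + complex.Im w.
Proof. by case: z w => [a b] [c d]. Qed.

Lemma ReN (R : realType) (z : R[i]) : complex.Re (- z) = - complex.Re z.
Proof. by case: z. Qed.

Lemma ImN (R : realType) (z : R[i]) : complex.Im (- z) = - complex.Im z.
Proof. by case: z. Qed.

(** The balls of [R[i]] have radii in [R[i]] itself. A radius positive for the order of [R[i]] has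
    zero imaginary part, so it is a positive real and the usual metric description follows. *)
Lemma nbhs_cmodP (R : realType) (z : R[i]) (A : set R[i]) :
  nbhs z A <-> exists2 e : R, 0 < e & forall w, cmod (w - z) < e -> A w.
Proof.
split.
- move=> /(@nbhs_ballP R[i] R[i])[e e0 eA].
  have /andP[/eqP ei er] : (complex.Im e == 0) && (0 < complex.Re e).
    by move: e0; rewrite /= ltcE /= eq_sym.
  exists (complex.Re e) => // w we; apply: eA.
  rewrite /ball /= norm_cmod cmodB.
  by case: (e) ei we => a b /= -> ?; rewrite ltcR.
- move=> [e e0 eA]; apply/(@nbhs_ballP R[i] R[i]).
  exists e%:C; first by rewrite /= ltcR.
  move=> w; rewrite /ball/= norm_cmod ltcR => ?; apply: eA.
  by rewrite cmodB.
Qed.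

Lemma open_cmodP (R : realType) (A : set R[i]) :
  open A <-> forall z, A z ->
    exists2 e : R, 0 < e & forall w, cmod (w - z) < e -> A w.
Proof.
rewrite openE; split => [h z /h|h z /h]; first by move/nbhs_cmodP.
by move=> ?; apply/nbhs_cmodP.
Qed.

Lemma continuous_complexP (R : realType) (f : R[i] -> R) :
  (forall z e, 0 < e -> exists2 d : R, 0 < d &
     forall w, cmod (w - z) < d -> `|f w - f z| < e) -> continuous f.
Proof.
move=> h z A /nbhs_ballP[e /= e0 eA].
have [d d0 hd] := h z e e0.
apply/nbhs_cmodP; exists d => // w /hd we; apply: eA.
by rewrite /ball/= distrC.
Qed.

Lemma cmod_dist (R : realType) (z w : R[i]) : `|cmod w - cmod z| <= cmod (w - z).
Proof.
rewrite ler_norml; apply/andP; split.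
  by have := cmodD_ge z (w - z); rewrite subrKC; lra.
by have := cmodD_ge w (- z); rewrite cmodN; lra.
Qed.

Lemma continuous_cmod (R : realType) : continuous (@cmod R).
Proof.
apply: continuous_complexP => z e e0; exists e => // w.
by apply: le_lt_trans; exact: cmod_dist.
Qed.

Lemma continuous_Re (R : realType) : continuous (@complex.Re R).
Proof.
apply: continuous_complexP => z e e0; exists e => // w.
by rewrite -ReN -ReD; apply: le_lt_trans; exact: Re_le_cmod.
Qed.

Lemma continuous_Im (R : realType) : continuous (@complex.Im R).
Proof.
apply: continuous_complexP => z e e0; exists e => // w.
by rewrite -ImN -ImD; apply: le_lt_trans; exact: Im_le_cmod.
Qed.

Lemma compact_box (R : realType) (a b c d : R) :
  compact [set z : R[i] | complex.Re z \in `[a, b] /\ complex.Im z \in `[c, d]].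
Proof.
pose h (p : R * R) : R[i] := p.1 +i* p.2.
rewrite (_ : [set z | _] = h @` (`[a, b] `*` `[c, d])); last first.
  apply/seteqP; split => [[x y] /= [xab ycd]|_ [[x y] /= [? ?] <-]//].
  by exists (x, y).
apply: continuous_compact; last exact/compact_setX/segment_compact/segment_compact.
apply: continuous_subspaceT => -[x y] A /= /nbhs_cmodP[e e0 eA].
have e2 : 0 < e / 2 by rewrite divr_gt0.
exists (ball x (e / 2), ball y (e / 2)) => /=.
  by split; exact: nbhsx_ballx.
move=> [u v] /= [xu yv]; apply: eA.
rewrite (le_lt_trans (cmod_le_ReIm _))//= (splitr e) ltrD//.
  by rewrite distrC.
by rewrite distrC.
Qed.

Lemma horner_bounded (R : realType) (p : {poly R[i]}) (M : R) : 0 <= M ->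
  exists2 B : R, 0 <= B & forall z, cmod z <= M -> cmod p.[z] <= B.
Proof.
move=> M0; elim/poly_ind: p => [|p c [B B0 hB]].
  by exists 0 => // z _; rewrite horner0 cmod0.
exists (B * M + cmod c); first by rewrite addr_ge0 ?mulr_ge0 ?cmod_ge0.
move=> z zM; rewrite !hornerE (le_trans (cmodD _ _))// lerD2r cmodM.
by rewrite ler_pM ?cmod_ge0// hB.
Qed.

Lemma horner_lipschitz (R : realType) (p : {poly R[i]}) (M : R) : 0 <= M ->
  exists2 L : R, 0 <= L & forall z w, cmod z <= M -> cmod w <= M ->
    cmod (p.[z] - p.[w]) <= L * cmod (z - w).
Proof.
move=> M0; elim/poly_ind: p => [|p c [L L0 hL]].
  by exists 0 => // z w _ _; rewrite !horner0 subr0 cmod0 mul0r.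
have [B B0 hB] := horner_bounded p M0.
exists (L * M + B); first by rewrite addr_ge0 ?mulr_ge0.
move=> z w zM wM; rewrite !hornerE.
have -> : p.[z] * z + c - (p.[w] * w + c) =
    (p.[z] - p.[w]) * z + p.[w] * (z - w) by ring.
rewrite (le_trans (cmodD _ _))// [leRHS]mulrDl !cmodM lerD//.
  by rewrite mulrAC ler_pM ?cmod_ge0// hL.
by rewrite ler_wpM2r ?cmod_ge0// hB.
Qed.

Lemma continuous_horner_complex (R : realType) (p : {poly R[i]}) :
  continuous (horner p : R[i] -> R[i]).
Proof.
move=> z A /nbhs_cmodP[e e0 eA]; apply/nbhs_cmodP.
have M0 : 0 <= cmod z + 1 by rewrite addr_ge0 ?cmod_ge0.
have [L L0 hL] := horner_lipschitz p M0.
have L1 : 0 < L + 1 by rewrite ltr_wpDl.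
exists (Num.min 1 (e / (L + 1))); first by rewrite lt_min ltr01 divr_gt0.
move=> w; rewrite lt_min => /andP[wz1 wze]; apply: eA.
have wM : cmod w <= cmod z + 1.
  rewrite -(subrK z w) addrC (le_trans (cmodD _ _))// lerD2l; exact: ltW.
rewrite (le_lt_trans (hL _ _ wM _)) ?lerDl//.
rewrite ltr_pdivlMr// in wze; rewrite (le_lt_trans _ wze)// mulrC.
by rewrite ler_wpM2l ?cmod_ge0// lerDl.
Qed.

Lemma compact_cmod_bounded (R : realType) (K : set R[i]) : compact K ->
  exists2 M : R, 0 < M & forall z, K z -> cmod z <= M.
Proof.
move=> cK.
have /compact_bounded[M [_ /(_ (M + 1))]] : compact (@cmod R @` K).
  apply: continuous_compact => //.
  exact/continuous_subspaceT/continuous_cmod.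
rewrite ltrDl ltr01 => /(_ isT) h.
exists (`|M| + 1); first by rewrite ltr_wpDl.
move=> z Kz; have := h (cmod z); rewrite /= (ger0_norm (cmod_ge0 _)).
move=> /(_ (ex_intro2 _ _ z Kz erefl)) /le_trans; apply.
by rewrite lerD2r ler_norm.
Qed.

Lemma complex_hausdorff (R : realType) : hausdorff_space R[i].
Proof. exact: norm_hausdorff. Qed.

(** * Growth of regular polynomial sequences *)

Lemma horner_lead (R : realType) (p : {poly R[i]}) (w : R[i]) : p != 0 ->
  p.[w] = \sum_(i < deg p) p`_i * w ^+ i + lead_coef p * w ^+ deg p.
Proof.
move=> p0; rewrite horner_coef /deg lead_coefE.
have -> : size p = (size p).-1.+1 by rewrite prednK// size_poly_gt0.
by rewrite big_ord_recr.
Qed.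

Lemma deg_neq0 (R : realType) (p : {poly R[i]}) : (0 < deg p)%N -> p != 0.
Proof. by apply: contraTneq => ->; rewrite /deg size_poly0. Qed.

Lemma regular_escape (R : realType) (f : nat -> {poly R[i]}) :
  regular_polynomial_sequence f ->
  exists2 rho : R, 1 <= rho & forall n w, (0 < n)%N -> rho <= cmod w ->
    2 * cmod w <= cmod (f n).[w].
Proof.
move=> [deg2 [A1 [A2 [A3 [A1p A2p A3p H]]]]].
(* With [r = |w|], the part [1 + 2 * A2] makes the lower terms at most half the leading one, through
   [(r - 1) * sum r^i <= r^d]. The part [4 / A1] makes the remaining half, at least [A1 * r^2 / 2],
   exceed [2 * r]. *)
exists (1 + 2 * A2 + 4 / A1).
  by rewrite -addrA lerDl addr_ge0// ?mulr_ge0 ?invr_ge0 ?ltW//.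
move=> n w n0 hw; have d2 := deg2 _ n0; have [h1 h2 _] := H _ n0.
have fn0 : f n != 0 by rewrite deg_neq0// (leq_trans _ d2).
set r := cmod w in hw *; set d := deg (f n) in d2 h2 *.
set a := cmod (lead_coef (f n)) in h1 h2.
have r4 : 4 / A1 <= r.
  by rewrite (le_trans _ hw)// lerDr addr_ge0// mulr_ge0// ltW.
have r2 : 2 * A2 <= r - 1.
  by rewrite lerBrDr addrC (le_trans _ hw)// lerDl divr_ge0// ltW.
have r1 : 1 < r by rewrite -subr_gt0 (lt_le_trans _ r2)// mulr_gt0.
have a0 : 0 < a by exact: lt_le_trans h1.
have low : cmod (\sum_(i < d) (f n)`_i * w ^+ i) <= a * r ^+ d / 2.
  apply: (@le_trans _ _ (\sum_(i < d) A2 * a * r ^+ i)).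
    rewrite (le_trans (cmod_sum _ _ _))//; apply: ler_sum => i _.
    by rewrite cmodM cmodX ler_wpM2r ?exprn_ge0 ?cmod_ge0// h2.
  rewrite -mulr_sumr.
  have e : (r - 1) * \sum_(i < d) r ^+ i <= r ^+ d.
    by rewrite -subrX1 lerBlDr lerDl.
  have s0 : 0 <= \sum_(i < d) r ^+ i.
    by apply: sumr_ge0 => i _; rewrite exprn_ge0// cmod_ge0.
  have e2 : 2 * A2 * \sum_(i < d) r ^+ i <= r ^+ d.
    by rewrite (le_trans _ e)// ler_wpM2r.
  have := ler_wpM2l (ltW a0) e2.
  by move=> ?; lra.
rewrite horner_lead// addrC (le_trans _ (cmodD_ge _ _))// -/d.
rewrite cmodM cmodX -/a -/r.
have rd : r ^+ 2 <= r ^+ d by rewrite ler_weXn2l// ltW.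
have hA : 2 * r <= a * r ^+ 2 / 2.
  rewrite expr2 mulrA mulrAC ler_wpM2r ?cmod_ge0//.
  rewrite ler_pdivlMr// (le_trans (_ : 2 * 2 <= A1 * r))//.
    by move: r4; rewrite ler_pdivrMr// (mulrC r) => r4; lra.
  by rewrite ler_wpM2r ?cmod_ge0.
have hB : a * r ^+ 2 / 2 <= a * r ^+ d / 2.
  by rewrite ler_wpM2r// ler_wpM2l// ltW.
by lra.
Qed.

(** The value is at most [(1 + A2 d) a exp (d l)] with [a] the modulus of the leading coefficient;
    then [1 + A2 d <= exp (A2 d)] and [a <= exp (A3 d)]. The exponential form is the one that can be
    iterated along the composition. *)
Lemma regular_growth (R : realType) (f : nat -> {poly R[i]}) :
  regular_polynomial_sequence f ->
  exists2 B : R, 0 <= B & forall n w l, (0 < n)%N -> 0 <= l ->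
    cmod w <= expR l -> cmod (f n).[w] <= expR ((deg (f n))%:R * (l + B)).
Proof.
move=> [deg2 [A1 [A2 [A3 [A1p A2p A3p H]]]]].
exists (A2 + A3); first by rewrite addr_ge0// ltW.
move=> n w l n0 l0 hw; have d2 := deg2 _ n0; have [h1 h2 h3] := H _ n0.
have fn0 : f n != 0 by rewrite deg_neq0// (leq_trans _ d2).
set d := deg (f n) in d2 h2 h3 *.
set a := cmod (lead_coef (f n)) in h1 h2 h3.
have a0 : 0 < a by exact: lt_le_trans h1.
have aE : a <= expR (A3 * d%:R) by rewrite -[leLHS]lnK ?ler_expR.
have wd : forall i, (i <= d)%N -> cmod w ^+ i <= expR (d%:R * l).
  move=> i id; rewrite (le_trans (lerXn2r _ _ _ hw)) ?nnegrE ?cmod_ge0 ?expR_ge0//.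
  by rewrite -expRM_natl ler_expR ler_wpM2r// ler_nat.
have hs : cmod (\sum_(i < d) (f n)`_i * w ^+ i) <= A2 * d%:R * (a * expR (d%:R * l)).
  apply: (@le_trans _ _ (\sum_(i < d) A2 * (a * expR (d%:R * l)))).
    rewrite (le_trans (cmod_sum _ _ _))//; apply: ler_sum => i _.
    rewrite cmodM cmodX mulrA ler_pM ?exprn_ge0 ?cmod_ge0//; first exact: h2.
    exact/wd/ltnW/ltn_ord.
  by rewrite sumr_const card_ord -[leLHS]mulr_natr mulrAC.
rewrite horner_lead// (le_trans (cmodD _ _))// -/d cmodM cmodX -/a.
have hl : a * cmod w ^+ d <= a * expR (d%:R * l) by rewrite ler_wpM2l ?wd// ltW.
rewrite (le_trans (lerD hs hl))//.
have -> : A2 * d%:R * (a * expR (d%:R * l)) + a * expR (d%:R * l) =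
   (1 + A2 * d%:R) * (a * expR (d%:R * l)) by ring.
have -> : d%:R * (l + (A2 + A3)) = A2 * d%:R + (A3 * d%:R + d%:R * l) by ring.
rewrite !expRD; apply: ler_pM.
- by rewrite addr_ge0 ?mulr_ge0// ltW.
- by rewrite mulr_ge0 ?expR_ge0// ltW.
- exact: expR_ge1Dx.
- by rewrite ler_wpM2r// expR_ge0.
Qed.

Lemma regular_lead (R : realType) (f : nat -> {poly R[i]}) :
  regular_polynomial_sequence f ->
  exists2 C : R, 0 <= C & forall n, (0 < n)%N ->
    `|ln (cmod (lead_coef (f n)))| <= C * (deg (f n))%:R.
Proof.
move=> [deg2 [A1 [A2 [A3 [A1p A2p A3p H]]]]].
exists (A3 + `|ln A1|); first by rewrite addr_ge0// ltW.
move=> n n0; have d2 := deg2 _ n0; have [h1 h2 h3] := H _ n0.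
have d1 : 1 <= (deg (f n))%:R :> R by rewrite ler1n (leq_trans _ d2).
have a0 : 0 < cmod (lead_coef (f n)) by exact: lt_le_trans h1.
have hA := ler_wpM2l (normr_ge0 (ln A1)) d1.
have hA3 := ler_wpM2l (ltW A3p) d1.
have hl : ln A1 <= ln (cmod (lead_coef (f n))) by rewrite ler_ln.
have h5 := ler_normlW (lexx `|ln A1|); have h6 := lerNnormlW (lexx `|ln A1|).
by rewrite ler_norml; apply/andP; split; lra.
Qed.

Definition Fdeg (R : realType) (f : nat -> {poly R[i]}) k : nat :=
  \prod_(1 <= i < k.+1) deg (f i).

Lemma Fdeg0 (R : realType) (f : nat -> {poly R[i]}) : Fdeg f 0 = 1%N.
Proof. by rewrite /Fdeg big_geq. Qed.

Lemma FdegS (R : realType) (f : nat -> {poly R[i]}) k :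
  Fdeg f k.+1 = (Fdeg f k * deg (f k.+1))%N.
Proof. by rewrite /Fdeg big_nat_recr. Qed.

Lemma deg_Fcomp (R : realType) (f : nat -> {poly R[i]}) k :
  deg (Fcomp f k) = Fdeg f k.
Proof.
elim: k => [|k IH]; first by rewrite Fdeg0 /deg size_polyX.
by rewrite FdegS /= /deg size_comp_poly -/(deg _) -IH mulnC.
Qed.

Lemma Fdeg_ge (R : realType) (f : nat -> {poly R[i]}) k :
  regular_polynomial_sequence f -> (2 ^ k <= Fdeg f k)%N.
Proof.
move=> [deg2 _]; elim: k => [|k IH]; first by rewrite Fdeg0.
by rewrite FdegS expnSr leq_mul// deg2.
Qed.

Lemma Fdeg_gt0 (R : realType) (f : nat -> {poly R[i]}) k :
  regular_polynomial_sequence f -> (0 < Fdeg f k)%N.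
Proof. by move=> /(Fdeg_ge k); apply: leq_trans; rewrite expn_gt0. Qed.

Lemma Fcomp_neq0 (R : realType) (f : nat -> {poly R[i]}) k :
  regular_polynomial_sequence f -> Fcomp f k != 0.
Proof. by move=> rf; rewrite deg_neq0// deg_Fcomp Fdeg_gt0. Qed.

Lemma lead_FcompS (R : realType) (f : nat -> {poly R[i]}) k :
  regular_polynomial_sequence f ->
  lead_coef (Fcomp f k.+1) =
    lead_coef (f k.+1) * lead_coef (Fcomp f k) ^+ deg (f k.+1).
Proof.
move=> rf; rewrite /= lead_coef_comp//.
have := Fdeg_gt0 k rf; rewrite -deg_Fcomp /deg.
by case: (size _) => [|[]].
Qed.

Lemma horner_FcompS (R : realType) (f : nat -> {poly R[i]}) k z :
  (Fcomp f k.+1).[z] = (f k.+1).[(Fcomp f k).[z]].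
Proof. by rewrite /= horner_comp. Qed.

(* The exponent [c_k] in [|lead F_k| = exp (c_k d_1...d_k)]. *)
Definition lead_rate (R : realType) (f : nat -> {poly R[i]}) k : R :=
  ln (cmod (lead_coef (Fcomp f k))) / (Fdeg f k)%:R.

(** The recursion for leading coefficients gives [c_(k+1) - c_k = ln |lead f_(k+1)| /
    (d_1...d_(k+1))]. The numerator is [O(d_(k+1))] and [d_1...d_k >= 2^k], so the increments decay
    geometrically. *)
Lemma lead_rate_cauchy (R : realType) (f : nat -> {poly R[i]}) :
  regular_polynomial_sequence f ->
  exists2 C : R, 0 <= C & forall m k, (m <= k)%N ->
    `|lead_rate f k - lead_rate f m| <= C / 2 ^+ m.
Proof.
move=> rf; have [C C0 hC] := regular_lead rf.
have step k : `|lead_rate f k.+1 - lead_rate f k| <= C / 2 ^+ k.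
  have D0 : 0 < (Fdeg f k)%:R :> R by rewrite ltr0n Fdeg_gt0.
  have d0 : 0 < (deg (f k.+1))%:R :> R.
    by rewrite ltr0n (leq_trans _ (rf.1 k.+1 _)).
  have l0 j : 0 < cmod (lead_coef (Fcomp f j)).
    by rewrite cmod_gt0 lead_coef_eq0 Fcomp_neq0.
  have f0 : 0 < cmod (lead_coef (f k.+1)).
    by rewrite cmod_gt0 lead_coef_eq0 deg_neq0// -(ltr0n R).
  rewrite /lead_rate lead_FcompS// cmodM cmodX lnM ?posrE// ?exprn_gt0//.
  rewrite lnXn// FdegS natrM -[ln _ *+ _]mulr_natr.
  set l := ln (cmod (lead_coef (f _))); set L := ln _.
  have -> : (l + L * (deg (f k.+1))%:R) / ((Fdeg f k)%:R * (deg (f k.+1))%:R)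
      - L / (Fdeg f k)%:R = (l / (deg (f k.+1))%:R) / (Fdeg f k)%:R.
    by field; rewrite !gt_eqF.
  rewrite normrM [`|_^-1|]normfV (gtr0_norm D0) ler_pM ?invr_ge0 ?ler0n//.
    by rewrite normrM normfV (gtr0_norm d0) ler_pdivrMr// hC.
  by rewrite lef_pV2 ?posrE ?exprn_gt0// -natrX ler_nat Fdeg_ge.
exists (2 * C); first by rewrite mulr_ge0.
move=> m k /subnK <-; move: (k - m)%N => {}k.
(* The right-hand side is the exact sum of the bounds on the increments, which is the form that
   induction on [k] preserves. *)
suff : `|lead_rate f (k + m) - lead_rate f m| <= 2 * C / 2 ^+ m - 2 * C / 2 ^+ (k + m).
  by move=> /le_trans; apply; rewrite gerBl divr_ge0 ?mulr_ge0 ?exprn_ge0.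
elim: k => [|k IH]; first by rewrite add0n !subrr normr0.
have := lerD IH (step (k + m)%N).
rewrite addSn; set a := lead_rate f (k + m); set b := lead_rate f (k + m).+1.
move=> h; rewrite (_ : b - lead_rate f m = (a - lead_rate f m) + (b - a)); last first.
  by ring.
rewrite (le_trans (ler_normD _ _))// (le_trans h)// exprS.
rewrite invfM -!mulrA (mulrA C 2^-1) (mulrC C 2^-1); lra.
Qed.

(** * The Julia set as the set of nonescaping points *)

Definition escape_radius (R : realType) (f : nat -> {poly R[i]}) (rho : R) :=
  1 <= rho /\ forall n w, (0 < n)%N -> rho <= cmod w ->
    2 * cmod w <= cmod (f n).[w].

(** When [rho] is an escape radius, an orbit that once exceeds [rho] tends to infinity. The fixed
    bound [rho] then expresses boundedness of the orbit, in a form that is visibly closed. *)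
Definition nonescaping (R : realType) (f : nat -> {poly R[i]}) (rho : R) :
  set R[i] := [set z | forall k, cmod (Fcomp f k).[z] <= rho].

Lemma escape_growth (R : realType) (f : nat -> {poly R[i]}) (rho : R) m z :
  escape_radius f rho -> rho <= cmod (Fcomp f m).[z] ->
  forall j, 2 ^+ j * cmod (Fcomp f m).[z] <= cmod (Fcomp f (j + m)).[z].
Proof.
move=> [rho1 esc] hz; elim=> [|j IH]; first by rewrite mul1r.
rewrite exprS -mulrA addSn horner_FcompS.
rewrite (le_trans (ler_wpM2l _ IH))// esc//.
rewrite (le_trans hz)// (le_trans _ IH)// ler_peMl ?cmod_ge0//.
by rewrite exprn_ege1// ler1n.
Qed.

Lemma escape_large (R : realType) (f : nat -> {poly R[i]}) (rho : R) m :
  escape_radius f rho -> forall M : R, \forall n \near \oo,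
    forall z, rho <= cmod (Fcomp f m).[z] -> M <= cmod (Fcomp f n).[z].
Proof.
move=> er M; near=> n => z hz.
have mn : (m <= n)%N by near: n; exact: nbhs_infty_ge.
have Mn : M <= (n - m)%N%:R.
  rewrite natrB// lerBrDr; near: n; exact: nbhs_infty_ger.
rewrite (le_trans Mn)// -(subnK mn) addnK.
rewrite (le_trans _ (escape_growth er hz _))//.
rewrite (le_trans (_ : _ <= 2 ^+ (n - m)))//.
  by rewrite -natrX ler_nat ltnW// ltn_expl.
by rewrite ler_peMr ?exprn_ge0// (le_trans _ hz)//; case: er.
Unshelve. all: by end_near. Qed.

Lemma open_escaping (R : realType) (p : {poly R[i]}) (rho : R) :
  open [set z : R[i] | rho < cmod p.[z]].
Proof.
have -> : [set z : R[i] | rho < cmod p.[z]] =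
    (@cmod R \o horner p) @^-1` [set x | rho < x] by [].
apply: open_comp; last exact: open_gt.
move=> z _; apply: continuous_comp; first exact: continuous_horner_complex.
exact: continuous_cmod.
Qed.

Lemma chordal_refl (R : realType) (p : sphere R) : chordal p p = 0.
Proof. by case: p => [z|]//=; rewrite subrr cmod0 mulr0 mul0r. Qed.

(** [montel_normal] quantifies over arbitrary index maps, not only increasing ones. Either one value
    recurs infinitely often, and a constant subsequence trivially converges, or the indices tend to
    infinity. *)
Lemma subsequence_dichotomy (s : nat -> nat) :
  exists2 t : nat -> nat, {homo t : m n / (m < n)%N} &
    (exists n, forall k, s (t k) = n) \/
    (forall n, \forall k \near \oo, (n <= s (t k))%N).
Proof.
have [[n hn]|hn] := pselect (exists n, forall N, exists k, (N <= k)%N /\ s k = n).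
- have /choice[c hc] := hn.
  exists (fix t k := if k is k'.+1 then c (t k').+1 else c 0%N).
    apply: ssrnat.homo_ltn; first by move=> ? ? ?; exact: ltn_trans.
    by move=> k; case: (hc ((fix t k := if k is k'.+1 then c (t k').+1 else c 0%N) k).+1).
  by left; exists n; case=> [|k] /=; exact: (proj2 (hc _)).
- exists id; first by [].
  right; elim=> [|n IH]; first by near=> k.
  have [N hN] : exists N, forall k, (N <= k)%N -> s k <> n.
    apply: contrapT => h; apply: hn; exists n => N; apply: contrapT => h2.
    by apply: h; exists N => k Nk skn; apply: h2; exists k.
  near=> k; rewrite ltn_neqAle; apply/andP; split; last by near: k.
  by apply/eqP => e; apply: (hN k) => //; near: k; exact: nbhs_infty_ge.
Unshelve. all: by end_near. Qed.

Lemma escaping_fatou (R : realType) (f : nat -> {poly R[i]}) (rho : R) m z :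
  escape_radius f rho -> rho < cmod (Fcomp f m).[z] -> fatou_set f (Some z).
Proof.
move=> er hz; exists (Some @` [set w : R[i] | rho < cmod (Fcomp f m).[w]]); split.
- exact/one_point_compactification_open_some/open_escaping.
- by exists z.
move=> s; have [t tinc [[n hn]|hn]] := subsequence_dichotomy s; exists t => //.
  exists (sphere_map (Fcomp f n.+1)) => K _ _ e e0.
  by near=> k => p _; rewrite hn chordal_refl.
exists (fun=> None) => K _ KU e e0.
(* The chordal distance from [w] to infinity is below [2 / |w|], hence the modulus [2 / e]. *)
have [N _ hN] := escape_large m er (2 / e).
near=> k => p /KU [w /= hw <-] /=.
have big : 2 / e <= cmod (Fcomp f (s (t k)).+1).[w].
  by apply: hN; [rewrite /= ltnW// ltnS; near: k; exact: hn|exact: ltW].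
rewrite horner_comp -horner_FcompS.
rewrite ltr_pdivrMr ?sqrtr_gt0 ?ltr_pwDl ?sqr_ge0//.
rewrite -ltr_pdivrMl// mulrC (le_lt_trans big)//.
rewrite -[ltLHS]ger0_norm ?cmod_ge0// -sqrtr_sqr ltr_sqrt ?ltrDr//.
by rewrite ltr_pwDl ?sqr_ge0.
Unshelve. all: by end_near. Qed.

(** This rules out a finite limit [v] at an escaping point: the hypothesis yields
    [1 + |z| <= 4 |z - v|], so iterates of large modulus keep a fixed chordal distance from [v]. *)
Lemma chordal_large (R : realType) (v : R[i]) (z : R[i]) :
  1 + 2 * cmod v <= cmod z ->
  (2 * (1 + cmod v))^-1 <= chordal (Some z) (Some v).
Proof.
move=> h; rewrite /chordal.
set a := cmod z in h *; set b := cmod v in h *.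
have a0 : 0 <= a by exact: cmod_ge0.
have b0 : 0 <= b by exact: cmod_ge0.
have sq (x : R) : 0 <= x -> Num.sqrt (1 + x ^+ 2) <= 1 + x.
  move=> x0; rewrite -[leRHS]ger0_norm ?addr_ge0// -sqrtr_sqr ler_wsqrtr//.
  by rewrite sqrrD expr1n mul1r; rewrite lerD2r lerDl mulrn_wge0.
have s0 (x : R) : 0 < Num.sqrt (1 + x ^+ 2) by rewrite sqrtr_gt0 ltr_pwDl ?sqr_ge0.
have d : a - b <= cmod (z - v) by rewrite (le_trans _ (cmodD_ge _ _))// cmodN.
rewrite ler_pdivlMr ?mulr_gt0//.
rewrite ler_pdivrMl ?mulr_gt0 ?ltr_pwDl//.
have := ler_pM (ltW (s0 a)) (ltW (s0 b)) (sq _ a0) (sq _ b0).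
move=> /le_trans; apply.
have hab : 1 + a <= 4 * cmod (z - v).
  by lra.
rewrite mulrC -mulrA (mulrCA (1 + b)) mulrC.
rewrite [leRHS](_ : _ = (4 * cmod (z - v)) * (1 + b)); last by ring.
by rewrite ler_wpM2r ?addr_ge0.
Qed.

(* A locally uniform limit near [z] equals infinity at every escaping point, so a
   single far iterate is already large at them, hence at [z] by continuity. *)
Lemma fatou_adherent_escaping (R : realType) (f : nat -> {poly R[i]}) (rho : R) z :
  escape_radius f rho -> fatou_set f (Some z) ->
  (forall e, 0 < e -> exists2 w, cmod (w - z) < e & ~ nonescaping f rho w) ->
  ~ nonescaping f rho z.
Proof.
move=> er [U [oU Uz nU]] adh nz.
have [t tinc [g hg]] := nU id.
have /nbhs_cmodP[e e0 eU] : nbhs z (Some @^-1` U : set R[i]).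
  have : nbhs (Some z : sphere R) U by exact: open_nbhs_nbhs.
  by [].
(* Two coordinates each within [e / 3] keep the closed square strictly inside the disc of radius
   [e]. *)
pose d := e / 3.
have d0 : 0 < d by rewrite divr_gt0.
pose B := [set w : R[i] | complex.Re w \in `[complex.Re z - d, complex.Re z + d] /\
   complex.Im w \in `[complex.Im z - d, complex.Im z + d]].
have cB : compact (Some @` B : set (sphere R)).
  apply: continuous_compact; last exact: compact_box.
  exact/continuous_subspaceT/one_point_compactification_some_continuous.
have BU : Some @` B `<=` U.
  move=> _ [w [/= + +] <-]; rewrite !in_itv/= => /andP[x1 x2] /andP[y1 y2].
  apply: eU; rewrite (le_lt_trans (cmod_le_ReIm _))//.
  rewrite ReD ImD ReN ImN.
  have : `|complex.Re w - complex.Re z| <= d by rewrite ler_norml; lra.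
  have : `|complex.Im w - complex.Im z| <= d by rewrite ler_norml; lra.
  by rewrite /d in d0 *; lra.
have unif := hg _ cB BU.
have tge k : (k <= t k)%N.
  by elim: k => // k IH; rewrite (leq_ltn_trans IH)// tinc.
have gB w : B w -> ~ nonescaping f rho w -> g (Some w) = None.
  move=> Bw /existsNP[m /negP]; rewrite -ltNge => /ltW hm.
  case E : (g (Some w)) => [v|//]; exfalso.
  have v0 : 0 < (2 * (1 + cmod v))^-1.
    by rewrite invr_gt0 mulr_gt0// ltr_pwDl// cmod_ge0.
  have [N1 _ h1] := unif _ v0.
  have [N2 _ h2] := escape_large m er (1 + 2 * cmod v).
  pose k := maxn N1 N2.
  have : chordal (Some (Fcomp f (t k).+1).[w]) (Some v) < (2 * (1 + cmod v))^-1.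
    by rewrite -E; exact: h1 k (leq_maxl _ _) (Some w) (ex_intro2 _ _ w Bw erefl).
  rewrite ltNge => /negP; apply; apply: chordal_large; apply: h2 => //=.
  by rewrite ltnW// ltnS (leq_trans (leq_maxr N1 N2)).
(* At chordal distance below this from infinity, the modulus exceeds [rho + 1]. The spare unit is
   what passing to [z] by continuity may lose. *)
have rho0 : 0 < 2 / (2 + rho).
  by rewrite divr_gt0// addr_gt0// (lt_le_trans ltr01)//; case: er.
have [N _ hN] := unif _ rho0.
have {hN} := hN N (leqnn _).
set n := (t N).+1 => hN.
have far w : B w -> ~ nonescaping f rho w -> rho + 1 < cmod (Fcomp f n).[w].
  move=> Bw nw; have := hN _ (ex_intro2 _ _ w Bw erefl).
  rewrite (gB _ Bw nw) /chordal [sphere_map _ _]/=.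
  set x := cmod _; have x0 : 0 <= x by exact: cmod_ge0.
  rewrite ltr_pdivrMr ?sqrtr_gt0 ?ltr_pwDl ?sqr_ge0//.
  rewrite mulrAC ltr_pdivlMr; last first.
    by rewrite addr_gt0// (lt_le_trans ltr01)//; case: er.
  rewrite ltr_pM2l// => h; suff : 2 + rho < 1 + x by lra.
  rewrite (lt_le_trans h)//.
  rewrite -[leRHS]ger0_norm ?addr_ge0// -sqrtr_sqr ler_wsqrtr//.
  by rewrite sqrrD expr1n mul1r lerD2r lerDl mulrn_wge0.
have [e1 e10 h1] : exists2 e : R, 0 < e & forall w, cmod (w - z) < e ->
    `|cmod (Fcomp f n).[w] - cmod (Fcomp f n).[z]| < 1.
  have hc : continuous (@cmod R \o horner (Fcomp f n)).
    move=> y; apply: continuous_comp; first exact: continuous_horner_complex.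
    exact: continuous_cmod.
  have hb : nbhs ((@cmod R \o horner (Fcomp f n)) z)
      (ball (cmod (Fcomp f n).[z]) 1) by exact: nbhsx_ballx.
  have /nbhs_cmodP[e1 e10 he] := hc z _ hb.
  by exists e1 => // w /he; rewrite /ball/= distrC.
have [w wz nw] := adh (Num.min d e1) (ltac:(by rewrite lt_min d0)).
move: wz; rewrite lt_min => /andP[wd we1].
have Bw : B w.
  have := le_lt_trans (Re_le_cmod _) wd; have := le_lt_trans (Im_le_cmod _) wd.
  rewrite ReD ImD ReN ImN !ltr_norml /B/= !in_itv/=.
  by move=> /andP[? ?] /andP[? ?]; split; apply/andP; split; lra.
have := far _ Bw nw; have := h1 _ we1; have := nz n.
by rewrite /= ltr_norml => ? /andP[? ?] ?; lra.
Qed.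

Lemma nonescapingN (R : realType) (f : nat -> {poly R[i]}) (rho : R) z :
  ~ nonescaping f rho z <-> exists m, rho < cmod (Fcomp f m).[z].
Proof.
split=> [/existsNP[m /negP]|[m h] /(_ m)]; last by rewrite leNgt h.
by rewrite -ltNge => h; exists m.
Qed.

Lemma escaping_near (R : realType) (f : nat -> {poly R[i]}) (rho : R) z :
  ~ nonescaping f rho z -> exists2 e : R, 0 < e &
    forall w, cmod (w - z) < e -> ~ nonescaping f rho w.
Proof.
move=> /nonescapingN[m hm].
have /open_cmodP/(_ z hm)[e e0 he] := @open_escaping R (Fcomp f m) rho.
by exists e => // w /he hw; apply/nonescapingN; exists m.
Qed.

(* Otherwise take the last point of the vertical ray through [z] that does not
   escape: it is a Fatou point adherent to the escaping set. *)
Lemma nonreal_escaping (R : realType) (f : nat -> {poly R[i]}) (rho : R) z :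
  escape_radius f rho -> julia_set f `<=` @sphere_real_line R ->
  complex.Im z != 0 -> ~ nonescaping f rho z.
Proof.
move=> er Jr z0 nz; set x := complex.Re z; set y := complex.Im z in z0.
pose T := [set t : R | 1 <= t /\ nonescaping f rho (x +i* (t * y))].
have y0 : 0 < `|y| by rewrite normr_gt0.
have T1 : T 1.
  by split=> //; rewrite mul1r; move: nz; rewrite /x /y; case: (z).
have ubT : ubound T (rho / `|y|).
  move=> t [t1 /(_ 0%N)]; rewrite /= hornerX => h.
  rewrite ler_pdivlMr// -(ger0_norm (le_trans ler01 t1)) -normrM.
  by rewrite (le_trans _ h)// (le_trans _ (Im_le_cmod _)).
have supT : has_sup T by split; [exists 1|exists (rho / `|y|)].
set s := sup T.
have s1 : 1 <= s by apply: sup_upper_bound => //.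
have dist (t u : R) : cmod ((x +i* (t * y)) - (x +i* (u * y))) = `|t - u| * `|y|.
  rewrite cmodE/= subrr expr0n add0r -mulrBl sqrtr_sqr normrM//.
have ns : ~ nonescaping f rho (x +i* (s * y)).
  apply: (fatou_adherent_escaping er).
    apply: contrapT => /Jr[r _ [_ /esym/eqP]].
    by rewrite mulf_eq0 (negbTE z0) orbF gt_eqF// (lt_le_trans ltr01).
  move=> e e0; exists (x +i* ((s + e / (2 * `|y|)) * y)).
    rewrite dist addrAC subrr add0r ger0_norm.
      rewrite (_ : e / (2 * `|y|) * `|y| = e / 2); first by rewrite ltr_pdivrMr//; lra.
      by field; rewrite -normr_eq0 normr_id gt_eqF.
    by rewrite divr_ge0 ?mulr_ge0// ltW.
  have d0 : 0 < e / (2 * `|y|) by rewrite divr_gt0// mulr_gt0.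
  move=> h; have : T (s + e / (2 * `|y|)).
    by split=> //; rewrite (le_trans s1)// lerDl ltW.
  by move/(sup_upper_bound supT); rewrite -/s gerDl leNgt d0.
(* Escaping is an open condition, whereas the supremum is approached by parameters whose points do
   not escape. *)
have [e e0 he] := escaping_near ns.
have [t Tt st] := sup_adherent (divr_gt0 e0 y0) supT.
have ts : t <= s by exact: sup_upper_bound.
case: Tt => _; apply: he; rewrite dist -ltr_pdivlMr// distrC ger0_norm ?subr_ge0//.
by rewrite -/s in st; lra.
Qed.

(** A nonescaping point must be real, and every real point is a limit of nonreal ones, which escape;
    by [fatou_adherent_escaping] it cannot then be a Fatou point. From here on the Julia set is
    handled only through orbits. *)
Lemma planar_julia (R : realType) (f : nat -> {poly R[i]}) (rho : R) :
  escape_radius f rho -> julia_set f `<=` @sphere_real_line R ->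
  planar_part (julia_set f) = nonescaping f rho.
Proof.
move=> er Jr; apply/seteqP; split=> z.
  move=> Jz; apply: contrapT => /nonescapingN[m hm].
  exact: Jz (escaping_fatou er hm).
move=> nz Fz; have [z0|z0] := eqVneq (complex.Im z) 0; last first.
  exact: nonreal_escaping er Jr z0 nz.
apply: (fatou_adherent_escaping er Fz) nz => e e0.
exists (z + (0 +i* (e / 2))).
  rewrite addrAC subrr add0r cmodE/= expr0n add0r sqrtr_sqr ger0_norm.
    by rewrite ltr_pdivrMr//; lra.
  by rewrite divr_ge0// ltW.
apply: (nonreal_escaping er Jr).
by rewrite ImD z0 add0r/= gt_eqF// divr_gt0.
Qed.

Lemma nonescaping_compact (R : realType) (f : nat -> {poly R[i]}) (rho : R) :
  compact (nonescaping f rho).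
Proof.
apply: (@subclosed_compact _ _ [set z : R[i] | complex.Re z \in `[- rho, rho] /\
    complex.Im z \in `[- rho, rho]]).
- rewrite -openC; apply/open_cmodP => z nz.
  by have [e e0 he] := escaping_near nz; exists e.
- exact: compact_box.
- move=> z /(_ 0%N); rewrite /= hornerX => h; rewrite !in_itv/= -!ler_norml.
  split; first exact: le_trans (Re_le_cmod _) h.
  exact: le_trans (Im_le_cmod _) h.
Qed.

(** Around a point that escapes at time [m], one neighbourhood escapes at time [m] too and stays
    large from some common time on; compactness makes the time uniform on [K]. *)
Lemma escaping_compact (R : realType) (f : nat -> {poly R[i]}) (rho : R)
    (K : set R[i]) : escape_radius f rho ->
  compact K -> K `<=` ~` nonescaping f rho ->
  exists m, forall z, K z -> rho <= cmod (Fcomp f m).[z].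
Proof.
move=> er /compact_near_coveringP cK KJ.
have [] := cK nat \oo (fun n z => rho <= cmod (Fcomp f n).[z]) _.
  move=> z /KJ /nonescapingN[m hm].
  have /open_cmodP/(_ z hm)[e e0 he] := @open_escaping R (Fcomp f m) rho.
  have [N _ hN] := escape_large m er rho.
  exists ([set w | cmod (w - z) < e], [set n | (N <= n)%N]) => /=.
    split; first by apply/nbhs_cmodP; exists e.
    by exists N.
  by move=> [w n] /= [/he /ltW hw Nn]; exact: hN.
by move=> N _ hN; exists N => z; apply: hN => /=.
Qed.

(** * Positivity of the logarithmic energy of neutral measures on a line *)

Lemma Re_real_scale (R : realType) (a : R) (z : R[i]) :
  complex.Re (a%:C * z) = a * complex.Re z.
Proof. by case: z => x y /=; rewrite mul0r subr0. Qed.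

Lemma Re_sum (R : realType) I (s : seq I) (F : I -> R[i]) :
  complex.Re (\sum_(i <- s) F i) = \sum_(i <- s) complex.Re (F i).
Proof. by elim/big_ind2: _ => [|x a y b <- <-|//]; rewrite ?ReD. Qed.

Lemma cmod_one_minus (R : realType) (t : R) (w : R[i]) :
  cmod (1 - t%:C * w) ^+ 2 =
  1 - 2 * complex.Re w * t + cmod w ^+ 2 * t ^+ 2.
Proof. by rewrite !sqr_cmod; case: w => a b /=; ring. Qed.

Lemma one_minus_inv (R : realType) (t : R) (w : R[i]) : 1 - t%:C * w != 0 ->
  complex.Re (w / (1 - t%:C * w)) =
  (complex.Re w - t * cmod w ^+ 2) / cmod (1 - t%:C * w) ^+ 2.
Proof.
rewrite -cmod_eq0 -sqrf_eq0 !sqr_cmod; case: w => a b /= h.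
by field; move: h; rewrite !mul0r subr0 addr0 sub0r.
Qed.

(** The mean value theorem is applied on [[0, 1]] to [ln |1 - t w|] plus the partial sum at [t w].
    The finite geometric sum leaves the derivative [- Re (w (t w)^N / (1 - t w))]. Writing
    [|1 - t w|^2] as a real polynomial [P] in [t] keeps the differentiation real. *)
Lemma ln_series_remainder (R : realType) (w : R[i]) (r : R) N :
  cmod w <= r -> r < 1 ->
  `|- ln (cmod (1 - w)) - \sum_(n < N) complex.Re (w ^+ n.+1) / n.+1%:R|
    <= r ^+ N.+1 / (1 - r).
Proof.
move=> wr r1.
have r0 : 0 <= r by rewrite (le_trans _ wr)// cmod_ge0.
pose P : {poly R} := 1 - (2 * complex.Re w) *: 'X + (cmod w ^+ 2) *: 'X^2.
pose S : {poly R} := \sum_(n < N) (complex.Re (w ^+ n.+1) / n.+1%:R) *: 'X^(n.+1).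
have PE t : P.[t] = cmod (1 - t%:C * w) ^+ 2.
  by rewrite cmod_one_minus /P !hornerE.
have tw (t : R) : t \in `[0, 1] -> cmod (t%:C * w) <= r.
  rewrite in_itv/= => /andP[t0 t1]; rewrite cmodM cmod_real ger0_norm//.
  by rewrite (le_trans _ wr)// ler_piMl// cmod_ge0.
have low (t : R) : t \in `[0, 1] -> 1 - r <= cmod (1 - t%:C * w).
  move=> /tw h; have := cmodD_ge 1 (- (t%:C * w)).
  by rewrite cmod1 cmodN; lra.
have pos (t : R) : t \in `[0, 1] -> 0 < cmod (1 - t%:C * w).
  by move=> /low; apply: lt_le_trans; rewrite subr_gt0.
pose phi : R -> R := (fun t : R => 2^-1 * ln P.[t]) \+ horner S.
pose dphi t := 2^-1 * (P.[t]^-1 * P^`().[t]) + S^`().[t].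
have der (t : R) : t \in `[0, 1] -> is_derive t (1 : R) phi (dphi t).
  move=> t01; apply: is_deriveD.
  apply: is_deriveZ; apply: is_derive1_comp.
  by apply: is_derive1_ln; rewrite PE exprn_gt0// pos.
have bnd (t : R) : t \in `[0, 1] -> `|dphi t| <= r ^+ N.+1 / (1 - r).
  move=> t01; have n0 : 1 - t%:C * w != 0 by rewrite -cmod_gt0 pos.
  have dS : S^`().[t] = complex.Re (w * \sum_(n < N) (t%:C * w) ^+ n).
    rewrite mulr_sumr Re_sum /S raddf_sum horner_sum; apply: eq_bigr => n _.
    rewrite /= derivZ derivXn /= hornerZ hornerMn hornerXn -mulr_natr.
    rewrite exprMn mulrCA -exprS -rmorphXn Re_real_scale.
    by field; rewrite addrC natr1 pnatr_eq0.
  have dP : 2^-1 * (P.[t]^-1 * P^`().[t]) = - complex.Re (w / (1 - t%:C * w)).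
    rewrite one_minus_inv// PE /P derivD derivB !derivZ derivX derivXn -polyC1 derivC !hornerE/=.
    by field; rewrite cmod_eq0.
  have -> : dphi t = - complex.Re (w * (t%:C * w) ^+ N / (1 - t%:C * w)).
    rewrite /dphi dP dS -!ReN -ReD; congr complex.Re.
    have e : (t%:C * w) ^+ N = 1 - (1 - t%:C * w) * \sum_(n < N) (t%:C * w) ^+ n.
      by rewrite -[LHS](subrK 1) subrX1; ring.
    by rewrite e; field.
  rewrite normrN (le_trans (Re_le_cmod _))// !cmodM cmodV cmodX exprS.
  rewrite ler_pM ?mulr_ge0 ?invr_ge0 ?exprn_ge0 ?cmod_ge0//.
    by rewrite ler_pM ?exprn_ge0 ?cmod_ge0// lerXn2r ?nnegrE ?cmod_ge0 ?tw.
  by rewrite lef_pV2 ?posrE ?subr_gt0 ?pos ?low.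
have der01 (t : R) : t \in `]0, 1[ -> is_derive t (1 : R) phi (dphi t).
  move=> t01; apply: der; move: t01; rewrite !in_itv/=.
  by move=> /andP[/ltW -> /ltW ->].
have cont : {within `[0, 1], continuous phi}.
  by apply: derivable_within_continuous => t /der [].
have [c c01] := MVT ltr01 der01 cont.
rewrite subr0 mulr1 => e.
have phi0 : phi 0 = 0.
  rewrite /phi/= PE mul0r subr0 cmod1 expr1n ln1 mulr0 add0r.
  rewrite horner_sum big1// => n _.
  by rewrite !hornerE expr0n mulr0.
have phi1 : phi 1 = ln (cmod (1 - w)) + \sum_(n < N) complex.Re (w ^+ n.+1) / n.+1%:R.
  rewrite /phi/= PE mul1r lnXn; last first.
    by have := pos 1; rewrite mul1r in_itv/= lexx ler01; exact.
  rewrite -[ln _ *+ _]mulr_natl mulrA mulVf// mul1r; congr (_ + _).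
  by rewrite horner_sum; apply: eq_bigr => n _; rewrite !hornerE expr1n mulr1.
rewrite -opprD normrN -phi1 -[phi 1]subr0 -phi0 e bnd//.
by move: c01; rewrite !in_itv/= => /andP[/ltW -> /ltW ->].
Qed.

(* A probability measure on [X], seen only through its integrals of continuous
   functions: this treats root averages and the given measure alike. *)
Definition mean (R : realType) (X : set R) (E : (R -> R) -> R) :=
  [/\ forall a (g h : R -> R), continuous g -> continuous h ->
        E (fun x => a * g x + h x) = a * E g + E h,
      forall g h : R -> R, continuous g -> continuous h ->
        (forall x, X x -> g x <= h x) -> E g <= E h &
      E (fun=> 1) = 1].

Definition mean_pairing (R : realType) (E F : (R -> R) -> R) (k : R -> R -> R) :=
  E (fun x => F (k x)).

Lemma continuousDM (R : realType) a (g h : R -> R) :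
  continuous g -> continuous h -> continuous (fun x => a * g x + h x).
Proof.
move=> cg ch x; apply: cvgD; last exact: ch.
by apply: cvgM; [exact: cvg_cst|exact: cg].
Qed.

Lemma mean_cst (R : realType) (X : set R) E (c : R) :
  mean X E -> E (fun=> c) = c.
Proof.
case=> lin _ E1.
have cc : continuous (fun _ : R => (1 : R)) by exact: cst_continuous.
have E0 : E (fun=> 0) = 0.
  rewrite (_ : (fun=> 0) = fun _ : R => - 1 * 1 + 1); last first.
    by apply/funext => x; rewrite mulr1 addNr.
  by rewrite (lin _ (fun=> 1) (fun=> 1))// E1 mulr1 addNr.
have := lin c _ _ cc (@cst_continuous _ R 0); rewrite E1 E0 mulr1 addr0 => h.
by rewrite -[RHS]h; congr E; apply/funext => x; rewrite mulr1 addr0.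
Qed.

Lemma meanD (R : realType) (X : set R) E (g h : R -> R) : mean X E ->
  continuous g -> continuous h -> E (fun x => g x + h x) = E g + E h.
Proof.
case=> lin _ _ cg ch; rewrite -[E g]mul1r -lin//; congr E.
by apply/funext => x; rewrite mul1r.
Qed.

Lemma meanZ (R : realType) (X : set R) E a (g : R -> R) : mean X E ->
  continuous g -> E (fun x => a * g x) = a * E g.
Proof.
move=> mE cg; have := mE; case=> lin _ _.
rewrite -[RHS]addr0 -[in RHS](mean_cst 0 mE) -lin//; last exact: cst_continuous.
by congr E; apply/funext => x; rewrite addr0.
Qed.

Lemma continuous_sumr (R : realType) I (s : seq I) (g : I -> R -> R) :
  (forall i, continuous (g i)) -> continuous (fun x => \sum_(i <- s) g i x).
Proof.
move=> cg; elim: s => [|i s IH].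
  under eq_fun do rewrite big_nil; exact: cst_continuous.
under eq_fun do rewrite big_cons.
by move=> x; apply: cvgD; [exact: cg|exact: IH].
Qed.

Lemma mean_sum (R : realType) (X : set R) E I (s : seq I) (g : I -> R -> R) :
  mean X E -> (forall i, continuous (g i)) ->
  E (fun x => \sum_(i <- s) g i x) = \sum_(i <- s) E (g i).
Proof.
move=> mE cg; elim: s => [|i s IH].
  by under eq_fun do rewrite big_nil; rewrite big_nil (mean_cst 0 mE).
under eq_fun do rewrite big_cons.
by rewrite big_cons (meanD mE)// ?IH//; exact: continuous_sumr.
Qed.

Lemma mean_close (R : realType) (X : set R) E (g h : R -> R) eta : mean X E ->
  continuous g -> continuous h -> (forall x, X x -> `|g x - h x| <= eta) ->
  `|E g - E h| <= eta.
Proof.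
move=> mE cg ch gh; have [_ mono _] := mE.
have cc : continuous (fun _ : R => eta) by exact: cst_continuous.
have D (g' h' : R -> R) : continuous g' -> continuous h' ->
    (forall x, X x -> g' x <= h' x + eta) -> E g' <= E h' + eta.
  move=> cg' ch' le; rewrite -[in leRHS](mean_cst eta mE) -(meanD mE)//.
  by apply: mono => // x; apply: cvgD; [exact: ch'|exact: cc].
have h1 : E g <= E h + eta.
  by apply: D => // x /gh; rewrite ler_norml => /andP[_]; lra.
have h2 : E h <= E g + eta.
  by apply: D => // x /gh; rewrite ler_norml => /andP[]; lra.
by rewrite ler_norml; apply/andP; split; lra.
Qed.

(* Only the terms pairing the two coordinates of the kernel survive on the
   neutral difference [E - F]. *)
Lemma mean_energy_ge (R : realType) (X : set R) E F (k : R -> R -> R)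
    (c eta : R) (h : R -> R) N (wt : 'I_N -> R) (al be : 'I_N -> R -> R) :
  mean X E -> mean X F ->
  (forall x, continuous (k x)) ->
  continuous (fun x => E (k x)) -> continuous (fun x => F (k x)) ->
  continuous h -> (forall n, continuous (al n)) -> (forall n, continuous (be n)) ->
  (forall x y, X x -> X y -> `|k x y - (c + h x + h y +
      \sum_(n < N) wt n * (al n x * al n y + be n x * be n y))| <= eta) ->
  \sum_(n < N) wt n * ((E (al n) - F (al n)) ^+ 2 + (E (be n) - F (be n)) ^+ 2)
   <= mean_pairing E E k - mean_pairing E F k - mean_pairing F E k
      + mean_pairing F F k + 4 * eta.
Proof.
move=> mE mF ck cE cF ch cal cbe hk.
have inner G x : mean X G -> X x ->
    `|G (k x) - (c + h x + G h + \sum_(n < N) (wt n * al n x * G (al n) +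
         wt n * be n x * G (be n)))| <= eta.
  move=> mG Xx.
  pose g y := c + h x + h y + \sum_(n < N) (wt n * al n x * al n y +
     wt n * be n x * be n y).
  have cs : forall n : 'I_N, continuous (fun y => wt n * al n x * al n y +
     wt n * be n x * be n y).
    move=> n; apply: continuousDM => // y.
    by apply: cvgM; [exact: cvg_cst|exact: cbe].
  have c1 : continuous (fun y => c + h x + h y).
    by move=> y; apply: cvgD; [exact: cvg_cst|exact: ch].
  have cg : continuous g.
    by move=> y; apply: cvgD; [exact: c1|exact: continuous_sumr].
  have -> : c + h x + G h + \sum_(n < N) (wt n * al n x * G (al n) +
         wt n * be n x * G (be n)) = G g.
    rewrite (meanD mG c1 (continuous_sumr cs)) (mean_sum _ mG cs).
    rewrite (meanD mG (@cst_continuous _ _ _) ch) (mean_cst _ mG).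
    congr (_ + _); apply: eq_bigr => n _.
    rewrite (meanD mG) ?(meanZ _ mG)//.
      by move=> y; apply: cvgM; [exact: cvg_cst|exact: cal].
    by move=> y; apply: cvgM; [exact: cvg_cst|exact: cbe].
  apply: (mean_close mG (ck x) cg) => y Xy.
  have := hk _ _ Xx Xy; congr (`|_ - (_ + _)| <= _).
  by apply: eq_bigr => n _; ring.
have outer H G : mean X H -> mean X G -> continuous (fun x => G (k x)) ->
    `|mean_pairing H G k - (c + H h + G h +
      \sum_(n < N) wt n * (H (al n) * G (al n) + H (be n) * G (be n)))| <= eta.
  move=> mH mG cG.
  pose g x := c + h x + G h + \sum_(n < N) (wt n * G (al n) * al n x +
     wt n * G (be n) * be n x).
  have cs : forall n : 'I_N, continuous (fun x => wt n * G (al n) * al n x +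
     wt n * G (be n) * be n x).
    move=> n; apply: continuousDM => // y.
    by apply: cvgM; [exact: cvg_cst|exact: cbe].
  have c0 : continuous (fun x => c + h x).
    by move=> y; apply: cvgD; [exact: cvg_cst|exact: ch].
  have c1 : continuous (fun x => c + h x + G h).
    by move=> y; apply: cvgD; [exact: c0|exact: cvg_cst].
  have cg : continuous g.
    by move=> y; apply: cvgD; [exact: c1|exact: continuous_sumr].
  have -> : c + H h + G h + \sum_(n < N) wt n * (H (al n) * G (al n) +
         H (be n) * G (be n)) = H g.
    rewrite (meanD mH c1 (continuous_sumr cs)) (mean_sum _ mH cs).
    rewrite (meanD mH c0 (@cst_continuous _ _ _)).
    rewrite (meanD mH (@cst_continuous _ _ _) ch) !(mean_cst _ mH).
    congr (_ + _); apply: eq_bigr => n _.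
    rewrite (meanD mH) ?(meanZ _ mH)//; first by ring.
      by move=> y; apply: cvgM; [exact: cvg_cst|exact: cal].
    by move=> y; apply: cvgM; [exact: cvg_cst|exact: cbe].
  apply: (mean_close mH cG cg) => x Xx.
  have := inner G _ mG Xx; congr (`|_ - (_ + _)| <= _).
  by apply: eq_bigr => n _; ring.
(* In the alternating sum of the four pairings the constant and the terms in [h] cancel, and the
   bilinear terms combine into squares. Each pairing costs one [eta]. *)
have := outer _ _ mE mE cE; have := outer _ _ mE mF cF.
have := outer _ _ mF mE cE; have := outer _ _ mF mF cF.
set s1 := \sum_(n < N) _; set s2 := \sum_(n < N) _; set s3 := \sum_(n < N) _.
set s4 := \sum_(n < N) _; set s5 := \sum_(n < N) _.
have -> : s5 = s4 - s3 - s2 + s1.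
  rewrite /s1 /s2 /s3 /s4 /s5 -!sumrB -big_split/=; apply: eq_bigr => n _.
  by ring.
rewrite !ler_norml => /andP[? ?] /andP[? ?] /andP[? ?] /andP[? ?]; lra.
Qed.

(** This is [- log |x - y + ie|]: the logarithmic kernel with one point raised to height [e]. It
    stays finite on the diagonal and increases to the true kernel as [e] decreases to 0. *)
Definition logk (R : realType) (e x y : R) : R :=
  - (2^-1 * ln ((x - y) ^+ 2 + e ^+ 2)).

Lemma continuous_logk (R : realType) (e x : R) : 0 < e -> continuous (logk e x).
Proof.
move=> e0 y; apply: cvgN; apply: cvgM; first exact: cvg_cst.
have pos : 0 < (x - y) ^+ 2 + e ^+ 2 by rewrite ltr_wpDl ?sqr_ge0 ?exprn_gt0.
apply: (@continuous_comp _ _ _ (fun y : R => (x - y) ^+ 2 + e ^+ 2)); last exact: continuous_ln.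
apply: cvgD; last exact: cvg_cst.
by apply: (@continuous_comp _ _ _ (fun y : R => x - y) (fun t => t ^+ 2));
  [apply: cvgB; [exact: cvg_cst|exact: cvg_id]|exact: exprn_continuous].
Qed.

Lemma continuous_complex_exp (R : realType) (g h : R -> R) n :
  continuous g -> continuous h ->
  continuous (fun x => complex.Re ((g x +i* h x) ^+ n)) /\
  continuous (fun x => complex.Im ((g x +i* h x) ^+ n)).
Proof.
move=> cg ch; elim: n => [|n [IHr IHi]].
  by split; under eq_fun do rewrite expr0; exact: cst_continuous.
have ReM (z w : R[i]) : complex.Re (z * w) =
    complex.Re z * complex.Re w - complex.Im z * complex.Im w.
  by case: z w => [? ?] [? ?].
have ImM (z w : R[i]) : complex.Im (z * w) =
    complex.Re z * complex.Im w + complex.Im z * complex.Re w.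
  by case: z w => [? ?] [? ?].
split.
  under eq_fun do rewrite exprS ReM.
  by move=> x; apply: cvgB; apply: cvgM; [exact: cg|exact: IHr|exact: ch|exact: IHi].
under eq_fun do rewrite exprS ImM.
by move=> x; apply: cvgD; apply: cvgM; [exact: cg|exact: IHi|exact: ch|exact: IHr].
Qed.

Lemma le_of_geometric (R : realType) (Z Q C s : R) : 0 <= s -> s < 1 ->
  (forall N, (0 < N)%N -> Z <= Q + C * s ^+ N) -> Z <= Q.
Proof.
move=> s0 s1 h.
have cv : (Q + C * s ^+ n) @[n --> \oo] --> Q + C * 0.
  apply: cvgD; first exact: cvg_cst.
  apply: cvgM; first exact: cvg_cst.
  by apply: cvg_expr; rewrite ger0_norm.
rewrite mulr0 addr0 in cv.
apply: (cvgr_to_ge cv); near=> n; apply: h.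
by near: n; exact: nbhs_infty_gt.
Unshelve. all: by end_near. Qed.

(** With [cauchy_im], the real and imaginary parts of [1 / (x - z)] for real [x] and
    [z = a + ib]. *)
Definition cauchy_re (R : realType) (a b x : R) := (x - a) / ((x - a) ^+ 2 + b ^+ 2).

Definition cauchy_im (R : realType) (a b x : R) := b / ((x - a) ^+ 2 + b ^+ 2).

Lemma continuous_cauchy (R : realType) (a b : R) : 0 < b ->
  continuous (cauchy_re a b) /\ continuous (cauchy_im a b).
Proof.
move=> b0; pose D (x : R) := (x - a) ^+ 2 + b ^+ 2.
have Dn x : D x != 0 by rewrite gt_eqF// ltr_wpDl ?sqr_ge0 ?exprn_gt0.
have cx : continuous (fun x : R => x - a).
  by move=> x; apply: cvgB; [exact: cvg_id|exact: cvg_cst].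
have cD : continuous D.
  move=> x; apply: cvgD; last exact: cvg_cst.
  by apply: (@continuous_comp _ _ _ (fun y : R => y - a) (fun t => t ^+ 2));
    [exact: cx|exact: exprn_continuous].
split=> x.
  by apply: cvgM; [exact: cx|apply: cvgV; [exact: Dn x|exact: cD]].
by apply: cvgM; [exact: cvg_cst|apply: cvgV; [exact: Dn x|exact: cD]].
Qed.

(* With [q = a - ib], [p = a + i(b - e)] and [u x = (x - p) / (x - q)], the kernel
   is [- ln |1 - u x * conj (u y)|] up to terms in [x] or [y] alone, because
   [1 - u x * conj (u y) = - i (2b - e) (x - y + ie) / ((x - q) * conj (y - q))];
   the first term of the logarithmic series already yields the resolvent. *)
Lemma log_energy_ge (R : realType) (X : set R) E F (a b e M : R) :
  mean X E -> mean X F -> 0 < e -> e < b ->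
  (forall x, X x -> (x - a) ^+ 2 + b ^+ 2 <= M) ->
  continuous (fun x => E (logk e x)) -> continuous (fun x => F (logk e x)) ->
  (2 * b - e) ^+ 2 * ((E (cauchy_re a b) - F (cauchy_re a b)) ^+ 2 +
                      (E (cauchy_im a b) - F (cauchy_im a b)) ^+ 2) <=
  mean_pairing E E (logk e) - mean_pairing E F (logk e)
  - mean_pairing F E (logk e) + mean_pairing F F (logk e).
Proof.
move=> mE mF e0 eb hM cE cF.
set A := cauchy_re a b; set B := cauchy_im a b.
have b0 : 0 < b by exact: lt_trans eb.
set kap := 2 * b - e; have kap0 : 0 < kap by rewrite /kap; lra.
pose D (x : R) := (x - a) ^+ 2 + b ^+ 2.
have D0 x : 0 < D x by rewrite ltr_wpDl ?sqr_ge0 ?exprn_gt0.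
have Dn x : D x != 0 by rewrite gt_eqF.
have cx : continuous (fun x : R => x - a).
  by move=> x; apply: cvgB; [exact: cvg_id|exact: cvg_cst].
have cD : continuous D.
  move=> x; apply: cvgD; last exact: cvg_cst.
  by apply: (@continuous_comp _ _ _ (fun y : R => y - a) (fun t => t ^+ 2));
    [exact: cx|exact: exprn_continuous].
have [cA cB] : continuous A /\ continuous B by exact: continuous_cauchy.
(* These are the two parts of [u x = 1 - i kap / (x - a + ib)], an affine image of the Cauchy
   kernel; that is why means of [u] give resolvents. *)
pose ur x := - kap * B x + 1; pose ui x := - kap * A x.
have cur : continuous ur by apply: continuousDM => //; exact: cst_continuous.
have cui : continuous ui by move=> x; apply: cvgM; [exact: cvg_cst|exact: cA].
pose u x : R[i] := ur x +i* ui x.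
pose h x := - (2^-1 * ln (D x)).
have ch : continuous h.
  move=> x; apply: cvgN; apply: cvgM; first exact: cvg_cst.
  by apply: (@continuous_comp _ _ _ D); [exact: cD|exact: continuous_ln].
have u2 x : cmod (u x) ^+ 2 = 1 - kap * e / D x.
  rewrite sqr_cmod/= /ur /ui /A /B /cauchy_re /cauchy_im /D /kap.
  by field; exact: Dn.
have key x y : cmod (1 - u x * (u y)^*%C) ^+ 2 =
    kap ^+ 2 * ((x - y) ^+ 2 + e ^+ 2) / (D x * D y).
  rewrite sqr_cmod/= /ur /ui /A /B /cauchy_re /cauchy_im /D /kap.
  by field; apply/andP; split; exact: Dn.
have kE x y : logk e x y = ln kap + h x + h y - ln (cmod (1 - u x * (u y)^*%C)).
  have pos : 0 < (x - y) ^+ 2 + e ^+ 2 by rewrite ltr_wpDl ?sqr_ge0 ?exprn_gt0.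
  have cpos : 0 < cmod (1 - u x * (u y)^*%C).
    rewrite lt_def cmod_ge0 andbT -sqrf_eq0 key gt_eqF//.
    by rewrite divr_gt0 ?mulr_gt0 ?exprn_gt0.
  have : ln (cmod (1 - u x * (u y)^*%C) ^+ 2) =
     2 * ln kap + ln ((x - y) ^+ 2 + e ^+ 2) - (ln (D x) + ln (D y)).
    rewrite key ln_div ?posrE ?mulr_gt0 ?exprn_gt0//.
    rewrite [ln (D x * _)]lnM ?posrE// [ln (_ * _)]lnM ?posrE ?exprn_gt0//.
    by rewrite [ln (kap ^+ 2)]lnXn// -[ln kap *+ 2]mulr_natl.
  rewrite lnXn// -[ln _ *+ 2]mulr_natl /logk /h; lra.
have [X0|/set0P[x0 Xx0]] := eqVneq X set0.
  have [_ mono E1] := mE.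
  have h10 : E (fun=> 1) <= E (fun=> 0).
    by apply: mono => [||x]; [exact: cst_continuous|exact: cst_continuous|rewrite X0].
  by move: h10; rewrite E1 (mean_cst 0 mE) ler10.
have M0 : 0 < M by exact: lt_le_trans (D0 x0) (hM _ Xx0).
(* Since [|u x|^2 = 1 - kap e / D x] and [D <= M] on [X], the values of [u] stay in a disc of radius
   less than 1. This needs [e > 0] and makes the logarithmic series converge uniformly on [X]. *)
pose s := 1 - kap * e / M.
have s1 : s < 1 by rewrite /s gtrBl divr_gt0// mulr_gt0.
have us x : X x -> cmod (u x) ^+ 2 <= s.
  move=> Xx; rewrite u2 /s lerD2l lerN2 ler_wpM2l ?mulr_ge0 ?(ltW kap0) ?(ltW e0)//.
  by rewrite lef_pV2 ?posrE// hM.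
have s0 : 0 <= s by rewrite (le_trans _ (us _ Xx0))// exprn_ge0// cmod_ge0.
apply: (@le_of_geometric _ _ _ (4 / (1 - s)) s) => // -[//|N] _.
pose wt (n : 'I_N.+1) : R := (n.+1%:R)^-1.
pose al (n : 'I_N.+1) x := complex.Re (u x ^+ n.+1).
pose be (n : 'I_N.+1) x := complex.Im (u x ^+ n.+1).
have cal n : continuous (al n) by exact: (continuous_complex_exp n.+1 cur cui).1.
have cbe n : continuous (be n) by exact: (continuous_complex_exp n.+1 cur cui).2.
have := @mean_energy_ge R X E F (logk e) (ln kap) (s ^+ N.+2 / (1 - s)) h _ wt al be
  mE mF (fun x => @continuous_logk R e x e0) cE cF ch cal cbe.
have hyp x y : X x -> X y -> `|logk e x y - (ln kap + h x + h y +
      \sum_(n < N.+1) wt n * (al n x * al n y + be n x * be n y))| <= s ^+ N.+2 / (1 - s).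
  move=> Xx Xy; rewrite kE opprD addrA (addrAC (_ + h y)) subrr sub0r.
  rewrite (_ : \sum_(n < _) _ =
     \sum_(n < N.+1) complex.Re ((u x * (u y)^*%C) ^+ n.+1) / n.+1%:R); last first.
    apply: eq_bigr => n _; rewrite mulrC exprMn -rmorphXn /al /be.
    by congr (_ / _); case: (u x ^+ _) (u y ^+ _) => [? ?] [? ?] /=; ring.
  apply: ln_series_remainder => //.
  rewrite -ler_sqr ?nnegrE ?cmod_ge0// cmodM cmod_conj exprMn [s ^+ 2]expr2.
  by rewrite ler_pM ?exprn_ge0 ?cmod_ge0 ?us//.
move=> /(_ hyp) main.
have al0 G : mean X G -> G (al ord0) = - kap * G B + 1.
  case=> lin _ G1; rewrite -[in RHS]G1 -lin//; exact: cst_continuous.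
have be0 G : mean X G -> G (be ord0) = - kap * G A.
  by move=> mG; rewrite -(meanZ _ mG).
have low : kap ^+ 2 * ((E A - F A) ^+ 2 + (E B - F B) ^+ 2) <=
    \sum_(n < N.+1) wt n * ((E (al n) - F (al n)) ^+ 2 + (E (be n) - F (be n)) ^+ 2).
  rewrite big_ord_recl !al0// !be0//.
  rewrite -[leLHS]addr0 lerD//; last first.
    by apply: sumr_ge0 => n _; apply: mulr_ge0; [by rewrite invr_ge0|by rewrite addr_ge0 ?sqr_ge0].
  by rewrite /wt/= invr1 mul1r le_eqVlt; apply/orP; left; apply/eqP; ring.
apply: (le_trans low); apply: (le_trans main); rewrite lerD2l -[leRHS]mulrA.
rewrite ler_wpM2l// mulrC ler_wpM2l ?invr_ge0 ?subr_ge0 ?(ltW s1)//.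
by rewrite exprS ler_piMl ?exprn_ge0// ltW.
Qed.

Lemma logkE (R : realType) (e x y : R) : 0 < e ->
  logk e x y = - ln (cmod ((x - y) +i* e)).
Proof.
move=> e0; have p : 0 < cmod ((x - y) +i* e).
  by rewrite cmod_gt0 eq_complex/= (gt_eqF e0) andbF.
rewrite /logk -[X in ln (X + _)]/(complex.Re ((x - y) +i* e) ^+ 2).
rewrite -[X in ln (_ + X)]/(complex.Im ((x - y) +i* e) ^+ 2) -sqr_cmod lnXn//.
by rewrite -[ln _ *+ 2]mulr_natl mulrA mulVf// mul1r.
Qed.

Lemma logkC (R : realType) (e x y : R) : logk e x y = logk e y x.
Proof. by rewrite /logk -sqrrN opprB. Qed.

(** The inequality [ln t <= t - 1] is applied to a quotient of moduli whose denominator is at least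
    [e]. *)
Lemma logk_le (R : realType) (e x y z : R) : 0 < e ->
  logk e x y <= logk e z y + `|x - z| / e.
Proof.
move=> e0; rewrite !logkE//.
have im (t : R) : e <= cmod (t +i* e).
  by rewrite (le_trans _ (Im_le_cmod _))//= ger0_norm// ltW.
have p (t : R) : 0 < cmod (t +i* e) by exact: lt_le_trans (im t).
rewrite -lerBlDl opprK addrC -ln_div ?posrE//.
have h : cmod ((z - y) +i* e) <= cmod ((x - y) +i* e) + `|x - z|.
  rewrite distrC -cmod_real.
  rewrite (_ : (z - y) +i* e = ((x - y) +i* e) + (z - x)%:C) ?cmodD//.
  by apply/eqP; rewrite eq_complex/=; apply/andP; split; apply/eqP; ring.
have q : 0 < cmod ((z - y) +i* e) / cmod ((x - y) +i* e) by rewrite divr_gt0.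
have := @le_ln1Dx R (cmod ((z - y) +i* e) / cmod ((x - y) +i* e) - 1).
rewrite addrCA subrr addr0 => /(_ _) l.
rewrite (le_trans (l _))//; first by lra.
rewrite lerBlDr ler_pdivrMr// mulrDl mul1r (le_trans h)// addrC lerD2r.
by rewrite mulrAC ler_pdivlMr// ler_wpM2l.
Qed.

Lemma logk_lipschitz (R : realType) (e x y z : R) : 0 < e ->
  `|logk e x y - logk e z y| <= `|x - z| / e.
Proof.
move=> e0; have := logk_le x y z e0; have := logk_le z y x e0.
by rewrite ler_norml (distrC z) => ? ?; apply/andP; split; lra.
Qed.

Lemma lipschitz_continuous (R : realType) (g : R -> R) (L : R) : 0 <= L ->
  (forall x y, `|g x - g y| <= L * `|x - y|) -> continuous g.
Proof.
move=> L0 h x; apply/cvgrPdist_lt => d d0.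
have L1 : 0 < L + 1 by rewrite ltr_wpDl.
near=> y; rewrite (le_lt_trans (h _ _))//.
have : `|x - y| < d / (L + 1).
  by near: y; apply/nbhs_ballP; exists (d / (L + 1)) => //=; exact: divr_gt0.
rewrite ltr_pdivlMr// mulrC; apply: le_lt_trans.
by rewrite ler_wpM2r// lerDl.
Unshelve. all: by end_near. Qed.

Lemma mean_logk_continuous (R : realType) (X : set R) E (e : R) :
  mean X E -> 0 < e -> continuous (fun x => E (logk e x)).
Proof.
move=> mE e0; apply: (@lipschitz_continuous _ _ e^-1); first by rewrite invr_ge0 ltW.
move=> x z; apply: (mean_close mE).
- exact: continuous_logk.
- exact: continuous_logk.
- by move=> y _; rewrite mulrC logk_lipschitz.
Qed.

(** * Logarithmic energy of measures on a real compact set *)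

Lemma measurable_open_complex (R : realType) (A : set R[i]) : open A ->
  measurable (A : set (borelC R)).
Proof. by move=> oA; exact: sub_sigma_algebra. Qed.

Lemma measurable_closed_complex (R : realType) (A : set R[i]) : closed A ->
  measurable (A : set (borelC R)).
Proof.
move=> cA; rewrite -(setCK (A : set (borelC R))); apply: measurableC.
by apply: measurable_open_complex; exact: closed_openC.
Qed.

Lemma continuous_measurable_complex (R : realType) (g : R[i] -> R) :
  continuous g -> measurable_fun [set: borelC R] (g : borelC R -> R).
Proof.
move=> cg; apply: (measurability _ (RGenOInfty.measurableE R)).
move=> _ [_ [a ->] <-]; rewrite setTI; apply: measurable_open_complex.
apply: open_comp => [z _|]; first exact: cg.
exact: interval_open.
Qed.

Lemma measurable_Re (R : realType) :
  measurable_fun [set: borelC R] (@complex.Re R : borelC R -> R).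
Proof. exact: (@continuous_measurable_complex R (@complex.Re R) (@continuous_Re R)). Qed.

Lemma measurable_Im (R : realType) :
  measurable_fun [set: borelC R] (@complex.Im R : borelC R -> R).
Proof. exact: (@continuous_measurable_complex R (@complex.Im R) (@continuous_Im R)). Qed.

(** The logarithmic kernel takes both signs and may have an infinite integral, so monotonicity is
    obtained from the positive and negative parts separately. *)
Lemma le_integral_measurable (R : realType) d (T : measurableType d)
    (mu : {measure set T -> \bar R}) (D : set T) (g h : T -> \bar R) :
  measurable D -> measurable_fun D g -> measurable_fun D h ->
  (forall x, D x -> (g x <= h x)%E) ->
  (\int[mu]_(x in D) g x <= \int[mu]_(x in D) h x)%E.
Proof.
move=> mD mg mh gh; rewrite integralE [leRHS]integralE leeB//.
- apply: ge0_le_integral => //; [exact: measurable_funepos|exact: measurable_funepos|].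
  by move=> x /gh fg; rewrite !funeposE ge_max !le_max fg lexx !orbT.
- apply: ge0_le_integral => //; [exact: measurable_funeneg|exact: measurable_funeneg|].
  by move=> x /gh; rewrite -leeN2 => fg; rewrite !funenegE ge_max !le_max fg lexx !orbT.
Qed.

Lemma integral_full (R : realType) d (T : measurableType d)
    (mu : probability T R) (D : set T) (g : T -> \bar R) :
  measurable D -> mu D = 1%E -> measurable_fun setT g ->
  (\int[mu]_x g x = \int[mu]_(x in D) g x)%E.
Proof.
move=> mD D1 mg; rewrite [RHS]integral_mkcond; apply: ae_eq_integral => //.
  by apply/(measurable_restrictT _ mD); exact: measurable_funTS.
exists (~` D); split; first exact: measurableC.
- by rewrite /= probability_setC// D1 subee.
- move=> x /= nx Dx; apply: nx => _; rewrite patchE mem_set//.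
Qed.

Lemma measurable_compact_complex (R : realType) (J : set R[i]) : compact J ->
  measurable (J : set (borelC R)).
Proof.
move=> cJ; apply: measurable_closed_complex.
by apply: compact_closed => //; exact: complex_hausdorff.
Qed.

(** Test functions live on the line and are pulled back along the real part, which is faithful when
    [J] is real. *)
Definition measure_mean (R : realType) (mu : probability (borelC R) R)
    (J : set R[i]) (g : R -> R) : R :=
  Rintegral mu (J : set (borelC R)) (fun z => g (complex.Re z)).

Lemma compact_integrable (R : realType) (mu : probability (borelC R) R)
    (J : set R[i]) (g : R[i] -> R) : compact J -> continuous g ->
  mu.-integrable (J : set (borelC R)) (EFin \o (g : borelC R -> R)).
Proof.
move=> cJ cg; have mJ := measurable_compact_complex cJ.
apply: measurable_bounded_integrable => //.
- by rewrite (le_lt_trans (probability_le1 mu mJ))// ltry.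
- by apply: measurable_funTS; exact: continuous_measurable_complex.
have /compact_bounded[M [Mr hM]] : compact (g @` J).
  by apply: continuous_compact => //; exact: continuous_subspaceT.
exists M; split=> // N /hM hN z Jz; apply: hN; by exists z.
Qed.

Lemma continuous_compRe (R : realType) (g : R -> R) : continuous g ->
  continuous (g \o @complex.Re R).
Proof.
by move=> cg z; apply: continuous_comp; [exact: continuous_Re|exact: cg].
Qed.

Lemma measure_mean_mean (R : realType) (mu : probability (borelC R) R)
    (J : set R[i]) : compact J -> (forall z, J z -> complex.Im z = 0) ->
  mu (J : set (borelC R)) = 1%E ->
  mean [set x : R | J x%:C] (measure_mean mu J).
Proof.
move=> cJ rJ J1.
have mJ := measurable_compact_complex cJ.
have int g : continuous g -> mu.-integrable (J : set (borelC R))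
    (EFin \o (fun z : borelC R => g (complex.Re z))).
  by move=> cg; apply: compact_integrable => //; exact: continuous_compRe.
split.
- move=> a g h cg ch; rewrite /measure_mean RintegralD//; last exact: int.
    by rewrite RintegralZl//; exact: int.
  apply: (int (fun x => a * g x)) => x.
  by apply: cvgM; [exact: cvg_cst|exact: cg].
- move=> g h cg ch gh; apply: le_Rintegral => //; [exact: int|exact: int|].
  move=> z Jz; apply: gh => /=.
  by move: (Jz); rewrite {1}(complexE z) (rJ _ Jz) mulr0 addr0.
- by rewrite /measure_mean Rintegral_cst// mul1r; move: J1 => /= ->.
Qed.

Lemma measurable_cmodB (R : realType) :
  measurable_fun [set: borelC R * borelC R]
    (fun p : borelC R * borelC R => cmod ((p.1 : R[i]) - (p.2 : R[i]))).
Proof.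
have -> : (fun p : borelC R * borelC R => cmod ((p.1 : R[i]) - (p.2 : R[i]))) =
   (@Num.sqrt R) \o (fun p => (complex.Re p.1 - complex.Re p.2) ^+ 2 +
      (complex.Im p.1 - complex.Im p.2) ^+ 2).
  by apply/funext => -[[a b] [c d]].
apply: measurableT_comp.
  apply: continuous_measurable_fun; exact: sqrt_continuous.
have mB (g : borelC R -> R) : measurable_fun setT g ->
    measurable_fun setT (fun p : borelC R * borelC R => (g p.1 - g p.2) ^+ 2).
  move=> mg; apply: (@measurable_funX _ _ _ setT (fun p => g p.1 - g p.2)).
  apply: measurable_funB; first exact: measurableT_comp mg measurable_fst.
  exact: measurableT_comp mg measurable_snd.
by apply: measurable_funD; apply: mB; [exact: measurable_Re|exact: measurable_Im].
Qed.

Lemma measurable_lne (R : realType) :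
  measurable_fun [set: R] (fun r : R => (- lne r%:E)%E).
Proof.
apply: measurableT_comp => //=.
apply: measurable_fun_ifT => //.
- exact: measurable_fun_ler.
- exact/measurable_EFinP.
Qed.

Lemma measurable_log_kernel (R : realType) :
  measurable_fun [set: borelC R * borelC R]
    (fun p : borelC R * borelC R => (- lne (cmod ((p.1 : R[i]) - (p.2 : R[i])))%:E)%E).
Proof.
apply: (@measurableT_comp _ _ _ _ _ _ (fun r : R => (- lne r%:E)%E)).
  exact: measurable_lne.
exact: measurable_cmodB.
Qed.

(** The kernel changes sign, so Tonelli is applied to its positive and negative parts. *)
Lemma measurable_potential (R : realType) (mu : probability (borelC R) R) :
  measurable_fun [set: borelC R] (fun z : borelC R =>
    (\int[mu]_w (- lne (cmod ((z : R[i]) - (w : R[i])))%:E))%E).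
Proof.
set k := fun p : borelC R * borelC R => (- lne (cmod ((p.1 : R[i]) - (p.2 : R[i])))%:E)%E.
have mk : measurable_fun setT k := @measurable_log_kernel R.
have -> : (fun z : borelC R => (\int[mu]_w (- lne (cmod ((z : R[i]) - (w : R[i])))%:E))%E) =
   (fun z => fubini_F mu (k^\+)%E z - fubini_F mu (k^\-)%E z)%E.
  apply/funext => z; rewrite integralE /fubini_F.
  by congr (_ - _)%E; apply: eq_integral => w _; rewrite ?funeposE ?funenegE.
apply: emeasurable_funB; apply: measurable_fun_fubini_tonelli_F => //.
- exact: measurable_funepos.
- exact: measurable_funeneg.
Qed.

Lemma log_energy_restrict (R : realType) (mu : probability (borelC R) R)
    (J : set (borelC R)) : measurable J -> mu J = 1%E ->
  log_energy mu =
  (\int[mu]_(z in J) \int[mu]_(w in J) (- lne (cmod ((z : R[i]) - (w : R[i])))%:E))%E.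
Proof.
move=> mJ J1; rewrite /log_energy (integral_full mJ J1 (measurable_potential mu)).
apply: eq_integral => z _; apply: integral_full => //.
exact: (measurable_fun_pair2 z (@measurable_log_kernel R)).
Qed.

Lemma logk_le_lne (R : realType) (e : R) (z w : R[i]) : 0 < e ->
  complex.Im z = 0 -> complex.Im w = 0 ->
  ((logk e (complex.Re z) (complex.Re w))%:E <= - lne (cmod (z - w))%:E)%E.
Proof.
move=> e0 z0 w0; have [->|zw] := eqVneq (z - w) 0.
  by rewrite cmod0 le0_lneNy// leey.
have p : 0 < cmod (z - w) by rewrite cmod_gt0.
rewrite lne_EFin// -EFinN lee_fin logkE// lerN2 ler_ln ?posrE//; last first.
  by rewrite cmod_gt0 eq_complex/= (gt_eqF e0) andbF.
rewrite !cmodE ler_wsqrtr// ReD ReN ImD ImN z0 w0 /= lerD2l subrr expr0n.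
exact: sqr_ge0.
Qed.

Lemma mean_pairing_le_log_energy (R : realType) (mu : probability (borelC R) R)
    (J : set R[i]) (e : R) : compact J -> (forall z, J z -> complex.Im z = 0) ->
  mu (J : set (borelC R)) = 1%E -> 0 < e ->
  ((mean_pairing (measure_mean mu J) (measure_mean mu J) (logk e))%:E
    <= log_energy mu)%E.
Proof.
move=> cJ rJ J1 e0.
have mJ := measurable_compact_complex cJ.
have int g : continuous g -> mu.-integrable (J : set (borelC R))
    (EFin \o (fun z : borelC R => g (complex.Re z))).
  by move=> cg; apply: compact_integrable => //; exact: continuous_compRe.
have inner (g : R -> R) : continuous g -> (measure_mean mu J g)%:E =
    (\int[mu]_(z in (J : set (borelC R))) (g (complex.Re z))%:E)%E.
  by move=> cg; rewrite /measure_mean /Rintegral fineK//; apply: integrable_fin_num => //; exact: int.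
have cp : continuous (fun x => measure_mean mu J (logk e x)).
  by apply: mean_logk_continuous e0; exact: measure_mean_mean.
rewrite (log_energy_restrict mJ J1) /mean_pairing inner//.
apply: le_integral_measurable => //.
- exact: (measurable_int mu (int _ cp)).
- apply: (eq_measurable_fun (fun z : borelC R =>
    (\int[mu]_w (- lne (cmod ((z : R[i]) - (w : R[i])))%:E))%E)).
    move=> z _; apply: integral_full => //.
    exact: (measurable_fun_pair2 z (@measurable_log_kernel R)).
  by apply: measurable_funTS; exact: measurable_potential.
move=> z Jz; rewrite inner; last exact: continuous_logk.
apply: le_integral_measurable => //.
- exact: (measurable_int mu (int _ (@continuous_logk R e (complex.Re z) e0))).
- apply: measurable_funTS.
  exact: (measurable_fun_pair2 z (@measurable_log_kernel R)).
by move=> w Jw; apply: logk_le_lne => //; exact: rJ.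
Qed.

Lemma logk_antitone (R : realType) (d e x y : R) : 0 < d -> d <= e ->
  logk e x y <= logk d x y.
Proof.
move=> d0 de; have e0 : 0 < e by exact: lt_le_trans de.
rewrite /logk lerN2 ler_wpM2l// ler_ln ?posrE ?ltr_wpDl ?sqr_ge0 ?exprn_gt0//.
by rewrite lerD2l lerXn2r ?nnegrE// ltW.
Qed.

Lemma logk_ge (R : realType) (M e x y : R) : 0 < e -> e <= 1 ->
  `|x| <= M -> `|y| <= M -> - (2^-1 * ln ((2 * M) ^+ 2 + 1)) <= logk e x y.
Proof.
move=> e0 e1 xM yM; have M0 : 0 <= M by exact: le_trans xM.
rewrite /logk lerN2 ler_wpM2l// ler_ln ?posrE ?ltr_wpDl ?sqr_ge0 ?exprn_gt0//.
rewrite lerD//; last by rewrite expr_le1// ltW.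
rewrite -(real_normK (num_real (x - y))) lerXn2r ?nnegrE ?mulr_ge0//.
by rewrite (le_trans (ler_normB _ _))// mulr2n mulrDl mul1r lerD.
Qed.

Lemma cvg_logk (R : realType) (z w : R[i]) :
  complex.Im z = 0 -> complex.Im w = 0 ->
  (logk n.+1%:R^-1 (complex.Re z) (complex.Re w))%:E @[n --> \oo] -->
    (- lne (cmod (z - w))%:E)%E.
Proof.
move=> z0 w0; have [zw|zw] := eqVneq (z - w) 0.
  rewrite zw cmod0 le0_lneNy//=.
  apply/cvgeyPge => A.
  have -> : complex.Re z = complex.Re w.
    by apply/eqP; rewrite -subr_eq0 -ReN -ReD zw.
  near=> n; rewrite lee_fin /logk subrr expr0n add0r exprVn lnV ?posrE ?exprn_gt0//.
  rewrite lnXn// -[ln _ *+ 2]mulr_natl mulrN opprK mulrA mulVf// mul1r.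
  rewrite -(expRK A) ler_ln ?posrE ?expR_gt0//.
  rewrite (@le_trans _ _ n%:R) ?ler_nat//; near: n; exact: nbhs_infty_ger.
have p : 0 < cmod (z - w) by rewrite cmod_gt0.
have p2 : (complex.Re z - complex.Re w) ^+ 2 = cmod (z - w) ^+ 2.
  by rewrite sqr_cmod ReD ReN ImD ImN z0 w0 subr0 expr0n addr0.
rewrite lne_EFin// -EFinN; apply/cvg_EFin; first by near=> n.
have -> : - ln (cmod (z - w)) = - (2^-1 * ln (cmod (z - w) ^+ 2 + 0 ^+ 2)).
  by rewrite expr0n addr0 lnXn// -[ln _ *+ 2]mulr_natl mulrA mulVf// mul1r.
rewrite /logk p2; apply: cvgN; apply: cvgM; first exact: cvg_cst.
apply: continuous_cvg.
  by apply: continuous_ln; rewrite expr0n addr0 exprn_gt0.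
apply: cvgD; first exact: cvg_cst.
exact: (@cvg_comp _ _ _ harmonic (fun t : R => t ^+ 2) _ _ _ (@cvg_harmonic R)
  (@exprn_continuous R 2 0)).
Unshelve. all: by end_near. Qed.

(** On [J] the kernels [logk (1/(n+1))] increase to the true kernel and are bounded below by [- C].
    Monotone convergence, after adding [C], bounds every true potential on [J] by [gam], and a
    second integration bounds the energy. *)
Lemma log_energy_le (R : realType) (mu : probability (borelC R) R)
    (J : set R[i]) (gam : R) : compact J -> (forall z, J z -> complex.Im z = 0) ->
  mu (J : set (borelC R)) = 1%E ->
  (forall x e, J x%:C -> 0 < e -> measure_mean mu J (logk e x) <= gam) ->
  (log_energy mu <= gam%:E)%E.
Proof.
move=> cJ rJ J1 hgam; have mJ := measurable_compact_complex cJ.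
have [M M0 hM] := compact_cmod_bounded cJ.
have mE := measure_mean_mean cJ rJ J1.
set C := 2^-1 * ln ((2 * M) ^+ 2 + 1).
have Jre z : J z -> z = (complex.Re z)%:C.
  by move=> Jz; rewrite {1}(complexE z) (rJ _ Jz) mulr0 addr0.
have mk (z : borelC R) : measurable_fun (J : set (borelC R))
    (fun w : borelC R => (- lne (cmod ((z : R[i]) - (w : R[i])))%:E)%E).
  by apply: measurable_funTS; exact: (measurable_fun_pair2 z (@measurable_log_kernel R)).
have inner z : J z ->
    (\int[mu]_(w in (J : set (borelC R))) (- lne (cmod ((z : R[i]) - (w : R[i])))%:E)
      <= gam%:E)%E.
  move=> Jz; set x := complex.Re z.
  have e0 n : 0 < n.+1%:R^-1 :> R by rewrite invr_gt0.
  pose g n (w : borelC R) := (logk n.+1%:R^-1 x (complex.Re w) + C)%:E.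
  have cl n : continuous (fun y => logk n.+1%:R^-1 x y + C).
    by move=> y; apply: cvgD; [exact: continuous_logk|exact: cvg_cst].
  have ig n : mu.-integrable (J : set (borelC R)) (g n).
    apply: (@compact_integrable R mu J (fun w => logk n.+1%:R^-1 x (complex.Re w) + C)) => //.
    exact: (continuous_compRe (cl n)).
  have g0 n w : J w -> (0 <= g n w)%E.
    move=> Jw; rewrite lee_fin -lerBlDr sub0r logk_ge//.
    - by rewrite invf_le1// ler1n.
    - exact: le_trans (Re_le_cmod _) (hM _ Jz).
    - exact: le_trans (Re_le_cmod _) (hM _ Jw).
  have ndg w : J w -> nondecreasing_seq (g^~ w).
    move=> Jw m n mn; rewrite lee_fin lerD2r logk_antitone//.
    by rewrite lef_pV2 ?posrE// ler_nat ltnS.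
  have gle n : (\int[mu]_(w in (J : set (borelC R))) g n w <= (gam + C)%:E)%E.
    have -> : (\int[mu]_(w in (J : set (borelC R))) g n w =
        (measure_mean mu J (fun y => (logk n.+1%:R^-1 x y + C)%R))%:E)%E.
      by rewrite /measure_mean /Rintegral fineK//; apply: integrable_fin_num => //; exact: ig.
    rewrite (meanD mE) ?(mean_cst _ mE) ?lee_fin ?lerD2r ?hgam//.
    - by rewrite -Jre.
    - exact: continuous_logk.
    - exact: cst_continuous.
  pose F (w : borelC R) := (- lne (cmod ((z : R[i]) - (w : R[i])))%:E + C%:E)%E.
  have mF : measurable_fun (J : set (borelC R)) F.
    by apply: emeasurable_funD; [exact: mk|exact: measurable_cst].
  have gF w : J w -> limn (g^~ w) = F w.
    move=> Jw; apply/cvg_lim => //; rewrite /g /F.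
    under eq_fun do rewrite EFinD.
    apply: cvgeD; last exact: cvg_cst.
      by rewrite fin_num_adde_defl.
    by apply: cvg_logk; exact: rJ.
  have Fle : (\int[mu]_(w in (J : set (borelC R))) F w <= (gam + C)%:E)%E.
    have := @cvg_monotone_convergence _ _ _ mu _ mJ g
      (fun n => measurable_int mu (ig n)) g0 ndg.
    rewrite (eq_integral F); last by move=> w; rewrite inE => /gF.
    by move=> h; apply: (cvge_to_le h); near=> n; exact: gle.
  have F0 w : J w -> (0 <= F w)%E.
    move=> Jw; rewrite -gF//; apply: lime_ge.
      exact: ereal_nondecreasing_is_cvgn (ndg _ Jw).
    by near=> n; exact: g0.
  have iF : mu.-integrable (J : set (borelC R)) F.
    apply/integrableP; split=> //.
    rewrite (eq_integral F); first exact: le_lt_trans Fle (ltry _).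
    by move=> w; rewrite inE => /F0; exact: gee0_abs.
  (* [F] is nonnegative with finite integral, hence integrable, and the constant [C] can be
     subtracted again. *)
  have -> : (\int[mu]_(w in (J : set (borelC R)))
      (- lne (cmod ((z : R[i]) - (w : R[i])))%:E) =
      \int[mu]_(w in (J : set (borelC R))) (F w - (cst C%:E) w))%E.
    by apply: eq_integral => w _; rewrite /F addeK.
  rewrite integralB//=; last exact: finite_measure_integrable_cst.
  by rewrite integral_cst//; move: J1 => /= ->; rewrite mule1 leeBlDr// -EFinD.
rewrite (log_energy_restrict mJ J1).
rewrite (@le_trans _ _ (\int[mu]_(z in (J : set (borelC R))) (cst gam%:E) z)%E)//.
  apply: le_integral_measurable => //.
  apply: (eq_measurable_fun (fun z : borelC R =>
    (\int[mu]_w (- lne (cmod ((z : R[i]) - (w : R[i])))%:E))%E)).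
    move=> z _; apply: integral_full => //.
    exact: (measurable_fun_pair2 z (@measurable_log_kernel R)).
  by apply: measurable_funTS; exact: measurable_potential.
by rewrite integral_cst//; move: J1 => /= ->; rewrite mule1.
Unshelve. all: by end_near. Qed.

(** * Limits of finitely supported measures *)

Lemma bounded_integrable (R : realType) d (T : measurableType d)
    (mu : {measure set T -> \bar R}) (D : set T) (g : T -> R) (B : R) :
  measurable D -> (mu D < +oo)%E -> measurable_fun D g ->
  (forall x, D x -> `|g x| <= B) -> mu.-integrable D (EFin \o g).
Proof.
move=> mD Dfin mg gB; apply: measurable_bounded_integrable => //.
exists B; split; first exact: num_real.
by move=> N BN x Dx; rewrite /= (le_trans (gB _ Dx))// ltW.
Qed.

Lemma Rintegral_uniform (R : realType) (g : R -> R) (B : R) :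
  measurable_fun [set: R] g -> (forall x, `|g x| <= B) ->
  Rintegral (uniform_prob (@ltr01 R)) setT g = Rintegral lebesgue_measure `[0, 1] g.
Proof.
move=> mg gB.
have lfin : (lebesgue_measure (`[0%R, 1%R]%classic : set R) < +oo)%E.
  by rewrite lebesgue_measure_itv/= lte_fin ltr01 oppr0 adde0 ltry.
have iU (h : R -> R) C : measurable_fun [set: R] h -> (forall x, `|h x| <= C) ->
    (uniform_prob (@ltr01 R)).-integrable setT (EFin \o h).
  move=> mh hC; apply: (@bounded_integrable _ _ _ _ _ _ C) => //.
  by rewrite (le_lt_trans (probability_le1 _ _)) ?ltry.
have iL (h : R -> R) C : measurable_fun [set: R] h -> (forall x, `|h x| <= C) ->
    lebesgue_measure.-integrable `[0, 1] (EFin \o h).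
  move=> mh hC; apply: (@bounded_integrable _ _ _ _ _ _ C) => //.
  exact: measurable_funTS.
have B0 x : 0 <= g x + B by have := gB x; rewrite ler_norml => /andP[]; lra.
(* Adding [B] makes the integrand nonnegative, the setting of the density formula for the uniform
   law; [B] cancels at the end. *)
have e : Rintegral (uniform_prob (@ltr01 R)) setT (fun x => g x + B) =
    Rintegral lebesgue_measure `[0, 1] (fun x => g x + B).
  rewrite /Rintegral integral_uniform.
  - by rewrite subr0 invr1 mul1e.
  - by apply/measurable_EFinP; apply: measurable_funD => //; exact: measurable_cst.
  - by move=> x; rewrite lee_fin.
have mB : measurable_fun [set: R] (fun=> B) by exact: measurable_cst.
have hB (x : R) : `|B| <= `|B| by [].
have eU : Rintegral (uniform_prob (@ltr01 R)) setT (fun x => g x + B) =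
    Rintegral (uniform_prob (@ltr01 R)) setT g + B.
  rewrite RintegralD//; [|exact: iU gB|exact: (iU _ _ mB (fun=> lexx `|B|))].
  have U1 : uniform_prob (@ltr01 R) [set: _] = 1%E by exact: (@probability_setT _ _ _ (uniform_prob (@ltr01 R))).
  by rewrite Rintegral_cst//; move: U1 => /= ->; rewrite mulr1.
have eL : Rintegral lebesgue_measure `[0, 1] (fun x => g x + B) =
    Rintegral lebesgue_measure `[0, 1] g + B.
  rewrite RintegralD//; [|exact: iL gB|exact: (iL _ _ mB (fun=> lexx `|B|))].
  rewrite Rintegral_cst//= lebesgue_measure_itv/= lte_fin ltr01 oppr0 adde0.
  by rewrite mulr1.
by move: e; rewrite eU eL => /addIr.
Qed.

(* On each of the [N] pieces the integrand varies by at most [L] times the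
   increment of [q]; the increments telescope. *)
Lemma riemann_sum_monotone (R : realType) (phi q : R -> R) (L M : R) N :
  (0 < N)%N -> 0 <= L -> (forall x y, `|phi x - phi y| <= L * `|x - y|) ->
  {homo q : x y / x <= y} -> (forall t, `|q t| <= M) ->
  `|Rintegral lebesgue_measure `[0, 1] (phi \o q) -
    N%:R^-1 * \sum_(j < N) phi (q (j%:R / N%:R))| <= 2 * M * L / N%:R.
Proof.
move=> N0 L0 lip qm qM; have NR : 0 < N%:R :> R by rewrite ltr0n.
have mphiq : measurable_fun [set: R] (phi \o q).
  apply: measurableT_comp; first by apply: continuous_measurable_fun; exact: lipschitz_continuous L0 lip.
  exact: nondecreasing_measurable.
have bnd t : `|(phi \o q) t| <= `|phi 0| + L * M.
  have := lip (q t) 0; rewrite subr0 => h.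
  rewrite /= -[phi (q t)](subrK (phi 0)) addrC (le_trans (ler_normD _ _))// lerD2l.
  by rewrite (le_trans h)// ler_wpM2l.
have int a b c d : lebesgue_measure.-integrable [set` Interval (BSide a c) (BSide b d)]
     (EFin \o (phi \o q)).
  apply: (@bounded_integrable _ _ _ _ _ _ (`|phi 0| + L * M)) => //.
    by rewrite /= lebesgue_measure_itv/=; case: ifP => // _; rewrite -EFinB ltry.
  exact: measurable_funTS.
have cell (a b : R) : a <= b ->
    `|Rintegral lebesgue_measure `]a, b] (phi \o q) - (b - a) * phi (q a)|
     <= (b - a) * (L * (q b - q a)).
  move=> ab.
  have cst c : Rintegral lebesgue_measure `]a, b] (fun=> c) = (b - a) * c.
    rewrite Rintegral_cst//= lebesgue_measure_itv/= lte_fin mulrC.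
    by move: ab; rewrite le_eqVlt => /orP[/eqP ->|->]; rewrite ?ltxx ?subrr//.
  have icst c : lebesgue_measure.-integrable `]a, b] (EFin \o (fun _ : R => c)).
    apply: (@bounded_integrable _ _ _ _ _ _ `|c|) => //.
    by rewrite /= lebesgue_measure_itv/=; case: ifP => // _; rewrite -EFinB ltry.
  have near t : t \in `]a, b] -> `|phi (q t) - phi (q a)| <= L * (q b - q a).
    rewrite in_itv/= => /andP[at' tb]; rewrite (le_trans (lip _ _))// ler_wpM2l//.
    by rewrite ger0_norm ?subr_ge0 ?lerD2r ?qm// ltW.
  have h1 : Rintegral lebesgue_measure `]a, b] (phi \o q) <=
      (b - a) * (phi (q a) + L * (q b - q a)).
    rewrite -cst; apply: le_Rintegral => // t /near; rewrite ler_norml => /andP[_] /=.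
    by lra.
  have h2 : (b - a) * (phi (q a) - L * (q b - q a)) <=
      Rintegral lebesgue_measure `]a, b] (phi \o q).
    rewrite -cst; apply: le_Rintegral => // t /near; rewrite ler_norml => /andP[] /=.
    by lra.
  by rewrite ler_norml; apply/andP; split; move: h1 h2; rewrite mulrDr mulrBr; lra.
have step k : (k <= N)%N -> `|Rintegral lebesgue_measure `[0, k%:R / N%:R] (phi \o q) -
    N%:R^-1 * \sum_(j < k) phi (q (j%:R / N%:R))| <= L / N%:R * (q (k%:R / N%:R) - q 0).
  elim: k => [|k IH] kN.
    rewrite big_ord0 mulr0 mul0r !subrr mulr0 subr0 set_itv1.
    by rewrite Rintegral_set1 normr0.
  have {IH} := IH (ltnW kN).
  set a := k%:R / N%:R; set b := k.+1%:R / N%:R.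
  have ba : b - a = N%:R^-1 by rewrite /a /b -mulrBl -natr1 addrAC subrr add0r mul1r.
  have ab : a <= b by rewrite -subr_ge0 ba invr_ge0 ltW.
  have a0 : 0 <= a by rewrite /a divr_ge0// ltW.
  pose I1 := Rintegral lebesgue_measure `[0, b] (phi \o q).
  pose I2 := Rintegral lebesgue_measure `[0, a] (phi \o q).
  have splitI : Rintegral lebesgue_measure `]a, b] (phi \o q) = I1 - I2.
    by rewrite /I1 /I2 (@Rintegral_itvB R)//; exact: int.
  have := cell _ _ ab; rewrite splitI ba big_ord_recr/=.
  rewrite [N%:R^-1 * (_ + phi _)]mulrDr -/a -/I1 -/I2.
  set S := N%:R^-1 * \sum_(_ < _) _ => h1 h2.
  rewrite (_ : I1 - (S + N%:R^-1 * phi (q a)) =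
    (I2 - S) + (I1 - I2 - N%:R^-1 * phi (q a))); last by ring.
  rewrite (le_trans (ler_normD _ _))// (le_trans (lerD h2 h1))//.
  by rewrite le_eqVlt; apply/orP; left; apply/eqP; ring.
have := step N (leqnn _); rewrite divff ?gt_eqF// => /le_trans; apply.
rewrite mulrAC (mulrC L) ler_wpM2r ?invr_ge0 ?(ltW NR)// ler_wpM2r//.
have := qM 1; have := qM 0; rewrite !ler_norml => /andP[? ?] /andP[? ?]; lra.
Qed.

(** For a sorted list, the empirical quantile function. The cap at the last index keeps [t >= 1] on
    the list instead of reading the default 0. *)
Definition quantile (R : realType) (s : seq R) (t : R) : R :=
  nth 0 s (minn (Num.truncn (t * (size s)%:R)) (size s).-1).

Lemma quantile_in (R : realType) (s : seq R) t : (0 < size s)%N ->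
  quantile s t \in s.
Proof.
move=> s0; apply: mem_nth; rewrite (leq_ltn_trans (geq_minr _ _))//.
by rewrite ltn_predL.
Qed.

Lemma quantile_homo (R : realType) (s : seq R) : (0 < size s)%N ->
  sorted <=%R s -> {homo quantile s : x y / x <= y}.
Proof.
move=> s0 ss x y xy; rewrite /quantile.
have lt_ n : (minn n (size s).-1 < size s)%N.
  by rewrite (leq_ltn_trans (geq_minr _ _))// ltn_predL.
apply: (sorted_leq_nth le_trans le_refl) => //; rewrite ?inE//.
rewrite leq_min geq_minr andbT (leq_trans (geq_minl _ _))//.
by rewrite le_truncn// ler_wpM2r.
Qed.

(** The average over the list is thus exactly a Riemann sum of its quantile function, with as many
    nodes as entries. *)
Lemma quantile_sum (R : realType) (s : seq R) (phi : R -> R) :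
  (0 < size s)%N ->
  \sum_(j < size s) phi (quantile s (j%:R / (size s)%:R)) = \sum_(y <- s) phi y.
Proof.
move=> s0; rewrite (big_nth 0) big_mkord; apply: eq_bigr => j _.
rewrite /quantile mulfVK ?pnatr_eq0 -?lt0n// natrK.
by rewrite (minn_idPl _)// -ltnS prednK.
Qed.

Lemma ultra_limit (R : realType) (X : set R) (G : set_system nat) (u : nat -> R) :
  UltraFilter G -> compact X -> (forall k, X (u k)) ->
  exists2 p, X p & u k @[k --> G] --> p.
Proof.
move=> GU cX Xu.
have FX : (u @ G) X by exact: (@filterE _ G _ (u @^-1` X) Xu).
have [p [Xp cp]] := cX (u @ G) _ FX.
exists p => // A Ap.
have [//|nA] := in_ultra_setVsetC (u @^-1` A) GU.
by have [y []] := cp (~` A) A nA Ap.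
Qed.

(* The quantile functions have a monotone pointwise limit along an ultrafilter,
   and Riemann sums of monotone functions converge uniformly; the law of the
   limit under the uniform measure on [0, 1] is the measure sought. *)
Lemma limit_measure (R : realType) (J : set R[i]) (s : nat -> seq R) (gam : R) :
  compact J -> (forall z, J z -> complex.Im z = 0) ->
  (forall k x, x \in s k -> J x%:C) -> (forall k, sorted <=%R (s k)) ->
  (forall k, (0 < size (s k))%N) ->
  (forall N, \forall k \near \oo, (N <= size (s k))%N) ->
  (forall x e, J x%:C -> 0 < e -> \forall k \near \oo,
     (size (s k))%:R^-1 * \sum_(y <- s k) logk e x y <= gam) ->
  exists2 nu : probability (borelC R) R, nu (J : set (borelC R)) = 1%E &
    forall x e, J x%:C -> 0 < e -> measure_mean nu J (logk e x) <= gam.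
Proof.
move=> cJ rJ sJ ss s0 slarge havg.
have mJ := measurable_compact_complex cJ.
have [M M0 hM] := compact_cmod_bounded cJ.
(* One ultrafilter makes the quantiles converge at every [t] simultaneously, and everything true for
   all large [k] holds along it. *)
have [G [GU GF]] := @ultraFilterLemma nat \oo _.
have GP : ProperFilter G by exact: ultra_proper.
pose X := [set x : R | J x%:C].
have cX : compact X.
  have -> : X = @complex.Re R @` J.
    apply/seteqP; split=> [x Jx|_ [z Jz <-]]; first by exists x%:C.
    by rewrite /X/=; move: (Jz); rewrite {1}(complexE z) (rJ _ Jz) mulr0 addr0.
  by apply: continuous_compact => //; exact/continuous_subspaceT/continuous_Re.
have /choice[q hq] : forall t, exists p, X p /\ quantile (s k) t @[k --> G] --> p.
  move=> t; have [p Xp cp] := @ultra_limit R X G (fun k => quantile (s k) t) GU cX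
    (fun k => sJ k _ (quantile_in t (s0 k))).
  by exists p.
have Xq t : X (q t) by case: (hq t).
have cq t : quantile (s k) t @[k --> G] --> q t by case: (hq t).
have qm : {homo q : x y / x <= y}.
  move=> x y xy; apply: (ler_cvg_to (cq x) (cq y)).
  by apply: filterE => k; exact: quantile_homo.
have XM x : X x -> `|x| <= M by move=> /hM; rewrite cmod_real.
have mq : measurable_fun [set: measurableTypeR R]
    (fun t : measurableTypeR R => (q t)%:C : borelC R).
  have mq : measurable_fun [set: R] q by exact: nondecreasing_measurable.
  apply: (measurability [set A : set (borelC R) | open (A : set R[i])] erefl).
  move=> _ [A oA <-]; rewrite setTI.
  rewrite (_ : _ @^-1` A = q @^-1` [set x : R | A x%:C])//.
  rewrite -[X in measurable X]setTI; apply: mq => //.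
  apply: open_measurable; rewrite openE => x Ax.
  have /open_cmodP/(_ _ Ax)[e e0 he] := oA.
  apply/nbhs_ballP; exists e => // y; rewrite /ball/= => xy; apply: he.
  by rewrite -rmorphB cmod_real distrC.
pose T := mfun_Sub (mem_set mq).
pose nu := distribution (uniform_prob (@ltr01 R)) T.
have nuJ : nu (J : set (borelC R)) = 1%E.
  rewrite /nu /distribution /pushforward /=.
  have -> : (fun t => (q t)%:C : borelC R) @^-1` J = [set: R].
    by apply/seteqP; split => // t _; exact: Xq.
  exact: (@probability_setT _ _ _ (uniform_prob (@ltr01 R))).
exists nu => // x e Jx e0.
pose phi := logk e x; pose L := e^-1.
have L0 : 0 <= L by rewrite invr_ge0 ltW.
have lip y z : `|phi y - phi z| <= L * `|y - z|.
  by rewrite /phi !(logkC e x) mulrC; exact: logk_lipschitz.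
have cphi : continuous phi by exact: lipschitz_continuous L0 lip.
have mphi : measurable_fun [set: R] phi by exact: continuous_measurable_fun.
have bnd t : `|phi (q t)| <= `|phi 0| + L * M.
  have := lip (q t) 0; rewrite subr0 => h.
  rewrite -[phi (q t)](subrK (phi 0)) addrC (le_trans (ler_normD _ _))// lerD2l.
  by rewrite (le_trans h)// ler_wpM2l// XM.
have mqR : measurable_fun [set: R] q by exact: nondecreasing_measurable.
have -> : measure_mean nu J phi = Rintegral lebesgue_measure `[0, 1] (phi \o q).
  rewrite -(@Rintegral_uniform R (phi \o q) (`|phi 0| + L * M))//; last first.
    exact: measurableT_comp.
  rewrite /measure_mean /Rintegral; congr fine.
  have mg : measurable_fun [set: borelC R]
      (fun z : borelC R => (phi (complex.Re z))%:E).
    apply/measurable_EFinP; apply: measurableT_comp => //; exact: measurable_Re.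
  have iU : (uniform_prob (@ltr01 R)).-integrable setT (EFin \o (phi \o q)).
    apply: (@bounded_integrable _ _ _ _ _ _ (`|phi 0| + L * M)) => //.
    - by rewrite (le_lt_trans (probability_le1 _ _)) ?ltry.
    - exact: measurableT_comp.
    - by move=> t _; exact: bnd.
  apply: (etrans (esym (integral_full mJ nuJ mg))).
  exact: (@integral_distribution _ _ _ _ _ (uniform_prob (@ltr01 R)) T _ mg iU).
(* Only finitely many nodes pass to the limit, so the number [N] of nodes is fixed. The three errors
   compare the integral with its [N]-node sum for [q], the same for the [k]-th quantile function,
   and the latter with its sum over all list entries, which is the list average. *)
have riem N : (0 < N)%N -> Rintegral lebesgue_measure `[0, 1] (phi \o q) <=
    gam + 3 * (2 * M * L / N%:R).
  move=> N0; set c := 2 * M * L / N%:R.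
  have c0 : 0 <= c by rewrite /c !mulr_ge0 ?invr_ge0// ltW.
  have h1 := riemann_sum_monotone N0 L0 lip qm (fun t => XM _ (Xq t)).
  pose S (r : R -> R) := N%:R^-1 * \sum_(j < N) phi (r (j%:R / N%:R)).
  have cS : S (quantile (s k)) @[k --> G] --> S q.
    apply: cvgM; first exact: cvg_cst.
    apply: (@cvg_big _ _ +%R 0 xpredT) => [|i _]; first exact: add_continuous.
    exact: continuous_cvg (cphi _) (cq _).
  have Sk : S q <= gam + 2 * c.
    apply: (cvgr_to_le cS); apply: GF.
    near=> k.
    have qk t : `|quantile (s k) t| <= M.
      by apply: XM; exact: sJ (quantile_in _ (s0 k)).
    have h2 := riemann_sum_monotone N0 L0 lip (quantile_homo (s0 k) (ss k)) qk.
    have h3 := riemann_sum_monotone (s0 k) L0 lip (quantile_homo (s0 k) (ss k)) qk.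
    have h4 : 2 * M * L / (size (s k))%:R <= c.
      rewrite /c ler_wpM2l ?mulr_ge0 ?(ltW M0)//.
      rewrite lef_pV2 ?posrE ?ltr0n// ler_nat; near: k; exact: slarge.
    have h5 : (size (s k))%:R^-1 * \sum_(y <- s k) logk e x y <= gam.
      by near: k; exact: havg.
    move: h2 h3; rewrite quantile_sum// -/c -/(S _) !ler_norml.
    by move=> /andP[? ?] /andP[? ?]; lra.
  by move: h1; rewrite -/c -/(S q) ler_norml => /andP[? ?]; lra.
apply/ler_addgt0Pr => d d0.
pose N := (Num.truncn (3 * (2 * M * L) / d)).+1.
have : 3 * (2 * M * L) / d < N%:R by exact: truncnS_gt.
rewrite ltr_pdivrMr// => /ltW h; rewrite (le_trans (riem N _))// lerD2l.
by rewrite mulrA ler_pdivrMr ?ltr0n// [leRHS]mulrC.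
Unshelve. all: by end_near. Qed.

(** * Energies of the root averages *)

Lemma split_real_roots (R : realType) (p : {poly R[i]}) : p != 0 ->
  (forall z, p.[z] = 0 -> complex.Im z = 0) ->
  exists rs : seq R, [/\ sorted <=%R rs, size rs = deg p,
    forall r, r \in rs -> p.[r%:C] = 0 &
    p = lead_coef p *: \prod_(r <- rs) ('X - r%:C%:P)].
Proof.
move=> p0 real; have [zs pE] := closed_field_poly_normal p.
have l0 : lead_coef p != 0 by rewrite lead_coef_eq0.
have zroot z : z \in zs -> p.[z] = 0.
  move=> zz; rewrite pE hornerZ horner_prod (big_rem z)//= hornerXsubC subrr.
  by rewrite mul0r mulr0.
have zE : zs = map (fun r : R => r%:C) (map (@complex.Re R) zs).
  rewrite -map_comp -[LHS]map_id; apply/eq_in_map => z /zroot /real z0 /=.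
  by rewrite [LHS]complexE z0 mulr0 addr0.
pose rs := sort <=%R (map (@complex.Re R) zs).
have prs : perm_eq rs (map (@complex.Re R) zs) by rewrite perm_sort.
exists rs; split.
- exact: sort_le_sorted.
- rewrite (perm_size prs) size_map [in RHS]pE /deg size_scale// size_prod_XsubC//.
- move=> r; rewrite (perm_mem prs) => rin; apply: zroot.
  by rewrite zE; exact: map_f.
- by rewrite (perm_big _ prs)/= -(big_map (fun r : R => r%:C) xpredT
    (fun z => 'X - z%:P)) -zE.
Qed.

Lemma Fcomp_eq_after (R : realType) (f : nat -> {poly R[i]}) k y z :
  (Fcomp f k).[y] = (Fcomp f k).[z] ->
  forall j, (Fcomp f (j + k)).[y] = (Fcomp f (j + k)).[z].
Proof. by move=> e; elim=> [//|j IH]; rewrite addSn !horner_FcompS IH. Qed.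

(** From time [k] on the two orbits coincide. Before it, an excursion beyond [rho] would persist up
    to time [k], where the orbit of [z] is still bounded by [rho]. *)
Lemma nonescaping_fiber (R : realType) (f : nat -> {poly R[i]}) (rho : R) k y z :
  escape_radius f rho -> nonescaping f rho z ->
  (Fcomp f k).[y] = (Fcomp f k).[z] -> nonescaping f rho y.
Proof.
move=> er nz e m; have [km|mk] := leqP k m.
  by rewrite -(subnK km) (Fcomp_eq_after e) subnK.
rewrite leNgt; apply/negP => hm.
have := nz k; rewrite /= -e leNgt => /negP; apply.
rewrite -(subnK (ltnW mk)) (lt_le_trans hm)//.
rewrite (le_trans _ (escape_growth er (ltW hm) _))//.
by rewrite ler_peMl ?cmod_ge0// exprn_ege1// ler1n.
Qed.

Lemma preimage_list (R : realType) (f : nat -> {poly R[i]}) (rho : R) k z0 :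
  regular_polynomial_sequence f -> escape_radius f rho ->
  (forall z, nonescaping f rho z -> complex.Im z = 0) ->
  nonescaping f rho z0 ->
  exists rs : seq R, [/\ sorted <=%R rs, size rs = Fdeg f k,
    forall r, r \in rs -> nonescaping f rho r%:C &
    Fcomp f k - (Fcomp f k).[z0]%:P =
      lead_coef (Fcomp f k) *: \prod_(r <- rs) ('X - r%:C%:P)].
Proof.
move=> rf er real nz0; set p := _ - _.
have szc : (size (- (Fcomp f k).[z0]%:P) < size (Fcomp f k))%N.
  rewrite size_polyN (leq_ltn_trans (size_polyC_leq1 _))//.
  by have := Fdeg_gt0 k rf; rewrite -deg_Fcomp /deg; case: (size _) => [|[]].
have lp : lead_coef p = lead_coef (Fcomp f k) by rewrite lead_coefDl.
have dp : deg p = Fdeg f k by rewrite /deg size_polyDl// -deg_Fcomp.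
have proot z : p.[z] = 0 -> nonescaping f rho z.
  rewrite !hornerE => /eqP; rewrite subr_eq0 => /eqP.
  exact: nonescaping_fiber.
have p0 : p != 0 by rewrite deg_neq0// dp Fdeg_gt0.
have [rs [srs szrs rsr pE]] := split_real_roots p0 (fun z h => real z (proot z h)).
exists rs; split=> //; first by rewrite szrs.
- by move=> r /rsr /proot.
- by rewrite -lp.
Qed.

Lemma sum_ln_roots (R : realType) (c : R[i]) (rs : seq R) z : c != 0 ->
  (c *: \prod_(r <- rs) ('X - r%:C%:P)).[z] != 0 ->
  \sum_(r <- rs) ln (cmod (z - r%:C)) =
  ln (cmod (c *: \prod_(r <- rs) ('X - r%:C%:P)).[z]) - ln (cmod c).
Proof.
move=> c0; rewrite hornerZ mulf_eq0 (negbTE c0)/= => pz.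
rewrite cmodM lnM ?posrE ?cmod_gt0// addrAC subrr add0r.
elim: rs pz => [|r rs IH]; first by rewrite !big_nil hornerC cmod1 ln1.
rewrite !big_cons hornerM hornerXsubC mulf_eq0 negb_or => /andP[zr pz].
by rewrite cmodM lnM ?posrE ?cmod_gt0// IH.
Qed.

Lemma deriv_div_roots (R : realType) (c : R[i]) (rs : seq R) z :
  let p := c *: \prod_(r <- rs) ('X - r%:C%:P) in
  p.[z] != 0 -> p^`().[z] / p.[z] = \sum_(r <- rs) (z - r%:C)^-1.
Proof.
rewrite /= derivZ !hornerZ mulf_eq0 negb_or => /andP[c0 pz].
rewrite -mulf_div divff// mul1r.
elim: rs pz => [|r rs IH]; first by rewrite !big_nil derivC horner0 mul0r.
rewrite !big_cons derivM derivXsubC mul1r hornerD !hornerM !hornerXsubC.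
rewrite mulf_eq0 negb_or => /andP[zr pz]; rewrite -IH//.
by field; rewrite zr pz.
Qed.

Lemma avg_logk_roots (R : realType) (f : nat -> {poly R[i]}) k z0 (rs : seq R) e x :
  regular_polynomial_sequence f -> 0 < e -> size rs = Fdeg f k ->
  Fcomp f k - (Fcomp f k).[z0]%:P =
      lead_coef (Fcomp f k) *: \prod_(r <- rs) ('X - r%:C%:P) ->
  (Fcomp f k).[x +i* e] != (Fcomp f k).[z0] ->
  (size rs)%:R^-1 * \sum_(r <- rs) logk e x r =
  lead_rate f k - ln (cmod ((Fcomp f k).[x +i* e] - (Fcomp f k).[z0])) / (Fdeg f k)%:R.
Proof.
move=> rf e0 szrs pE ne; set c := lead_coef _ in pE.
have c0 : c != 0 by rewrite lead_coef_eq0 Fcomp_neq0.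
have hE : (c *: \prod_(r <- rs) ('X - r%:C%:P)).[x +i* e] =
    (Fcomp f k).[x +i* e] - (Fcomp f k).[z0] by rewrite -pE !hornerE.
have := @sum_ln_roots R c rs (x +i* e) c0.
rewrite hE subr_eq0 => /(_ ne) s.
rewrite (eq_bigr (fun r => - ln (cmod ((x +i* e) - r%:C)))); last first.
  by move=> r _; rewrite logkE//; congr (- ln (cmod _)); rewrite /= -[RHS]/((x - r) +i* (e - 0)) subr0.
by rewrite sumrN s opprB /lead_rate szrs -/c mulrC mulrBl.
Qed.

Definition seq_mean (R : realType) (s : seq R) (g : R -> R) : R :=
  (size s)%:R^-1 * \sum_(y <- s) g y.

Lemma seq_mean_mean (R : realType) (X : set R) (s : seq R) : (0 < size s)%N ->
  (forall x, x \in s -> X x) -> mean X (seq_mean s).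
Proof.
move=> s0 sX; have sR : 0 < (size s)%:R :> R by rewrite ltr0n.
split.
- move=> a g h _ _; rewrite /seq_mean big_split/= mulrDr -mulr_sumr.
  by congr (_ + _); rewrite mulrCA.
- move=> g h _ _ gh; rewrite /seq_mean ler_wpM2l ?invr_ge0 ?(ltW sR)//.
  by rewrite big_seq [leRHS]big_seq; apply: ler_sum => x /sX; exact: gh.
- by rewrite /seq_mean big_const_seq count_predT iter_addr_0 mulVf// gt_eqF.
Qed.

(** One of the means is a finite average, so exchanging the order is finite linearity together with
    the symmetry of [logk]. *)
Lemma seq_mean_pairing_sym (R : realType) (X : set R) E (s : seq R) (e : R) :
  mean X E -> 0 < e ->
  mean_pairing E (seq_mean s) (logk e) = mean_pairing (seq_mean s) E (logk e).
Proof.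
move=> mE e0; rewrite /mean_pairing /seq_mean.
have cl y : continuous (logk e ^~ y).
  rewrite (_ : logk e ^~ y = logk e y); first exact: continuous_logk.
  by apply/funext => x; rewrite logkC.
rewrite (meanZ _ mE); last exact: (continuous_sumr cl).
rewrite (mean_sum _ mE cl); congr (_ * _); apply: eq_bigr => y _.
by congr E; apply/funext => x; rewrite logkC.
Qed.

(** The translate of [J] by [ie] is compact and off the real line, so it escapes uniformly. The
    bound [rho + 1] makes [|F_k(x + ie) - F_k(z0)|] at least 1, hence its logarithm nonnegative. *)
Lemma julia_shift_escapes (R : realType) (f : nat -> {poly R[i]}) (rho e : R) :
  escape_radius f rho -> (forall z, nonescaping f rho z -> complex.Im z = 0) ->
  0 < e -> \forall k \near \oo, forall x, nonescaping f rho x%:C ->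
    rho + 1 <= cmod (Fcomp f k).[x +i* e].
Proof.
move=> er real e0.
pose K := (fun z : R[i] => z + (0 +i* e)) @` nonescaping f rho.
have cK : compact K.
  apply: continuous_compact; last exact: nonescaping_compact.
  apply: continuous_subspaceT => z A /nbhs_cmodP[d d0 dA]; apply/nbhs_cmodP.
  by exists d => // w wz; apply: dA; rewrite opprD addrACA subrr addr0.
have KJ : K `<=` ~` nonescaping f rho.
  move=> _ [z nz <-] /real; rewrite ImD (real _ nz) add0r/= => h.
  by rewrite h ltxx in e0.
have [m hm] := escaping_compact er cK KJ.
apply: filterS (escape_large m er (rho + 1)) => k hk x nx.
apply/hk/hm; exists x%:C => //.
by apply/eqP; rewrite eq_complex/= addr0 add0r !eqxx.
Qed.

(** One step sends the exponent [l] to [d (l + B)]. As [d >= 2], this is at most [d (l + 2B) - 2B],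
    so the exponent shifted by [2B] is at most multiplied by the degree. *)
Lemma Fcomp_growth (R : realType) (f : nat -> {poly R[i]}) (B l : R) m z :
  regular_polynomial_sequence f -> 0 <= B -> 0 <= l ->
  (forall n w l, (0 < n)%N -> 0 <= l ->
    cmod w <= expR l -> cmod (f n).[w] <= expR ((deg (f n))%:R * (l + B))) ->
  cmod (Fcomp f m).[z] <= expR l -> forall j,
  cmod (Fcomp f (j + m)).[z] <=
    expR ((Fdeg f (j + m))%:R / (Fdeg f m)%:R * (l + 2 * B) - 2 * B).
Proof.
move=> rf B0 l0 gr hz.
have Dm : 0 < (Fdeg f m)%:R :> R by rewrite ltr0n Fdeg_gt0.
have Dle j : (Fdeg f m <= Fdeg f (j + m))%N.
  elim: j => // j IH; rewrite addSn FdegS (leq_trans IH)// leq_pmulr//.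
  by rewrite (leq_trans _ (rf.1 _ _)).
elim=> [|j IH]; first by rewrite divff ?gt_eqF// mul1r addrK.
have lj : 0 <= (Fdeg f (j + m))%:R / (Fdeg f m)%:R * (l + 2 * B) - 2 * B.
  rewrite subr_ge0 (@le_trans _ _ (1 * (l + 2 * B)))//.
    by rewrite mul1r lerDr.
  by rewrite ler_wpM2r ?addr_ge0 ?mulr_ge0// ler_pdivlMr// mul1r ler_nat.
rewrite addSn horner_FcompS (le_trans (gr _ _ _ _ lj IH))// ler_expR.
rewrite FdegS natrM.
have d2 : 2 <= (deg (f (j + m).+1))%:R :> R by rewrite ler_nat rf.1.
have := ler_wpM2r B0 d2; set d := (deg _)%:R; set D := (Fdeg f (j + m))%:R.
set T := l + 2 * B => h.
have -> : D * d / (Fdeg f m)%:R * T = d * (D / (Fdeg f m)%:R * T) by ring.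
by lra.
Qed.

(** First [m] is fixed with [d_1...d_m] large. For small [e] the point [x + ie] is still within
    [rho + 1] after [m] steps, by the Lipschitz bound on [F_m]. Growth starts only there, so the
    logarithm at time [k] is [O(d_1...d_k / d_1...d_m)], with [d] independent of [k]. *)
Lemma julia_shift_slow (R : realType) (f : nat -> {poly R[i]}) (rho eta : R) :
  regular_polynomial_sequence f -> escape_radius f rho -> 0 < eta ->
  exists2 d : R, 0 < d & forall e, 0 < e -> e <= d ->
    \forall k \near \oo, forall x z0, nonescaping f rho x%:C ->
      nonescaping f rho z0 ->
      rho + 1 <= cmod (Fcomp f k).[x +i* e] ->
      ln (cmod ((Fcomp f k).[x +i* e] - (Fcomp f k).[z0])) / (Fdeg f k)%:R <= eta.
Proof.
move=> rf er eta0; have [B B0 gr] := regular_growth rf.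
have rho1 : 1 <= rho by case: er.
have rho0 : 0 <= rho by exact: le_trans rho1.
pose l := ln (rho + 1).
have l0 : 0 <= l by rewrite ln_ge0// lerDr.
pose A := l + 2 * B + rho.
have A0 : 0 <= A by rewrite !addr_ge0// mulr_ge0.
pose m := (Num.truncn (A / eta)).+1.
have mA : A / (Fdeg f m)%:R <= eta.
  rewrite ler_pdivrMr ?ltr0n ?Fdeg_gt0// mulrC -ler_pdivrMr//.
  rewrite (le_trans (ltW (truncnS_gt _)))// ler_nat.
  by rewrite (leq_trans _ (Fdeg_ge m rf))// ltnW// ltn_expl.
have [L L0 hL] := horner_lipschitz (Fcomp f m) (addr_ge0 rho0 (@ler01 R)).
have L1 : 0 < L + 1 by rewrite ltr_wpDl.
exists (Num.min 1 (L + 1)^-1); first by rewrite lt_min ltr01 invr_gt0.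
move=> e e0; rewrite le_min => /andP[e1 eL].
near=> k => x z0 nx nz big.
have mk : (m <= k)%N by near: k; exact: nbhs_infty_ge.
have xb : cmod x%:C <= rho by have := nx 0%N; rewrite /= hornerX.
have start : cmod (Fcomp f m).[x +i* e] <= expR l.
  rewrite lnK ?posrE ?ltr_wpDl//.
  rewrite -(subrKC (Fcomp f m).[x%:C] (Fcomp f m).[x +i* e]).
  rewrite (le_trans (cmodD _ _))// lerD//.
  have eE : cmod ((x +i* e) - x%:C) = e.
    by rewrite cmodE/= subrr expr0n add0r subr0 sqrtr_sqr ger0_norm// ltW.
  rewrite (le_trans (hL _ _ _ _))//.
  - by rewrite -(subrKC x%:C (x +i* e)) (le_trans (cmodD _ _))// lerD// eE.
  - by rewrite (le_trans xb)// lerDl.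
  - rewrite eE (@le_trans _ _ ((L + 1) * (L + 1)^-1))//.
      by rewrite ler_pM ?(ltW e0)// lerDl.
    by rewrite divff// gt_eqF.
have := Fcomp_growth rf B0 l0 gr start (k - m); rewrite subnK//.
set D := (Fdeg f k)%:R; set D' := (Fdeg f m)%:R in mA *.
have D0 : 0 < D by rewrite ltr0n Fdeg_gt0.
have D'0 : 0 < D' by rewrite ltr0n Fdeg_gt0.
have DD : D' <= D.
  rewrite /D /D' ler_nat -(subnK mk); elim: (k - m)%N => // j IH.
  rewrite addSn FdegS (leq_trans IH)// leq_pmulr//.
  by rewrite (leq_trans _ (rf.1 _ _)).
set l' := D / D' * (l + 2 * B) => hF.
have l'0 : 0 <= l' by rewrite !mulr_ge0 ?invr_ge0 ?addr_ge0 ?mulr_ge0// ltW.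
have up : cmod ((Fcomp f k).[x +i* e] - (Fcomp f k).[z0]) <= expR (l' + rho).
  rewrite (le_trans (cmodD _ _))// cmodN expRD.
  have h1 : cmod (Fcomp f k).[x +i* e] <= expR l'.
    by rewrite (le_trans hF)// ler_expR gerBl mulr_ge0.
  have h2 : 1 <= expR l' by rewrite -expR0 ler_expR.
  have h3 := expR_ge1Dx rho.
  have h4 := ler_wpM2l (expR_ge0 l') h3.
  have h5 := ler_wpM2r rho0 h2.
  have := nz k; rewrite /= => h6; lra.
have pos : 0 < cmod ((Fcomp f k).[x +i* e] - (Fcomp f k).[z0]).
  rewrite (lt_le_trans ltr01)// (le_trans _ (cmodD_ge _ _))// cmodN.
  by have := nz k; rewrite /=; lra.
rewrite ler_pdivrMr// (@le_trans _ _ (l' + rho))//.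
  by rewrite -[leRHS]expRK ler_ln ?posrE ?expR_gt0.
rewrite (@le_trans _ _ (A / D' * D))//; last by rewrite ler_wpM2r// ltW.
rewrite /A mulrDl mulrDl /l' lerD//.
  by rewrite le_eqVlt; apply/orP; left; apply/eqP; ring.
by rewrite -mulrA ler_peMr// mulrC ler_pdivlMr// mul1r.
Unshelve. all: by end_near. Qed.

Lemma avg_logk_le (R : realType) (f : nat -> {poly R[i]}) (rho e x : R) k z0
    (rs : seq R) : regular_polynomial_sequence f -> 0 < e ->
  nonescaping f rho z0 -> size rs = Fdeg f k ->
  Fcomp f k - (Fcomp f k).[z0]%:P =
      lead_coef (Fcomp f k) *: \prod_(r <- rs) ('X - r%:C%:P) ->
  rho + 1 <= cmod (Fcomp f k).[x +i* e] ->
  seq_mean rs (logk e x) =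
    lead_rate f k - ln (cmod ((Fcomp f k).[x +i* e] - (Fcomp f k).[z0])) / (Fdeg f k)%:R
  /\ seq_mean rs (logk e x) <= lead_rate f k.
Proof.
move=> rf e0 nz szrs pE big; have h := nz k.
have ge1 : 1 <= cmod ((Fcomp f k).[x +i* e] - (Fcomp f k).[z0]).
  by rewrite (le_trans _ (cmodD_ge _ _))// cmodN; move: h => /=; lra.
have ne : (Fcomp f k).[x +i* e] != (Fcomp f k).[z0].
  by rewrite -subr_eq0 -cmod_gt0 (lt_le_trans ltr01).
have avg := avg_logk_roots rf e0 szrs pE ne.
split; first exact: avg.
by rewrite /seq_mean avg gerBl divr_ge0// ln_ge0.
Qed.

Lemma equilibrium_energy_le (R : realType) (f : nat -> {poly R[i]}) (rho : R)
    (mu : probability (borelC R) R) (gam : R) z0 :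
  regular_polynomial_sequence f -> escape_radius f rho ->
  (forall z, nonescaping f rho z -> complex.Im z = 0) ->
  nonescaping f rho z0 ->
  is_equilibrium_measure (nonescaping f rho) mu ->
  (\forall k \near \oo, lead_rate f k <= gam) ->
  (log_energy mu <= gam%:E)%E.
Proof.
move=> rf er real nz0 [_ mumin] hgam.
have cJ := @nonescaping_compact R f rho.
have /choice[rs hrs] := fun k => preimage_list k rf er real nz0.
have [|||N|x e nx e0|nu nuJ hnu] :=
    @limit_measure R (nonescaping f rho) rs gam cJ real.
- by move=> k x; have [_ _ + _] := hrs k; exact.
- by move=> k; have [] := hrs k.
- by move=> k; have [_ -> _ _] := hrs k; exact: Fdeg_gt0.
- near=> k; have [_ -> _ _] := hrs k; rewrite (leq_trans _ (Fdeg_ge k rf))//.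
  rewrite (leq_trans _ (ltnW (ltn_expl k (ltnSn 1))))//.
  by near: k; exact: nbhs_infty_ge.
- near=> k; have [_ szk _ pE] := hrs k.
  have big : rho + 1 <= cmod (Fcomp f k).[x +i* e].
    have := nx; near: k; apply: filterS (julia_shift_escapes er real e0) => k + ?.
    exact.
  have [_ h] := avg_logk_le rf e0 nz0 szk pE big.
  by rewrite (le_trans h)//; near: k; exact: hgam.
exact: le_trans (mumin nu nuJ) (log_energy_le cJ real nuJ hnu).
Unshelve. all: by end_near. Qed.

(** The energy of the neutral difference [E - F] for the kernel [logk e], expanded bilinearly. *)
Definition energy_gap (R : realType) (E F : (R -> R) -> R) (e : R) :=
  mean_pairing E E (logk e) - mean_pairing E F (logk e)
  - mean_pairing F E (logk e) + mean_pairing F F (logk e).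

(* With [c_k] the exponent of the leading coefficient, the three energies are at
   most [c_k + o(1)], at least [c_k - eta] for the mixed one, and at most [c_k]. *)
Lemma energy_gap_small (R : realType) (f : nat -> {poly R[i]}) (rho : R)
    (mu : probability (borelC R) R) z0 (rs : nat -> seq R) (tau d0 : R) :
  regular_polynomial_sequence f -> escape_radius f rho ->
  (forall z, nonescaping f rho z -> complex.Im z = 0) ->
  nonescaping f rho z0 ->
  is_equilibrium_measure (nonescaping f rho) mu ->
  (forall k, [/\ sorted <=%R (rs k), size (rs k) = Fdeg f k,
    forall r, r \in rs k -> nonescaping f rho r%:C &
    Fcomp f k - (Fcomp f k).[z0]%:P =
      lead_coef (Fcomp f k) *: \prod_(r <- rs k) ('X - r%:C%:P)]) ->
  0 < tau -> 0 < d0 ->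
  exists e, [/\ 0 < e, e < d0 &
    \forall k \near \oo,
      energy_gap (measure_mean mu (nonescaping f rho)) (seq_mean (rs k)) e <= tau].
Proof.
move=> rf er real nz0 eqmu hrs tau0 d00.
have cJ := @nonescaping_compact R f rho.
have [C C0 hC] := lead_rate_cauchy rf.
(* One [eta] is spent on the energy of [mu], one on each of the two mixed terms, and one on the
   distance between [c_k] and [c_m]. *)
pose eta := tau / 4; have eta0 : 0 < eta by rewrite divr_gt0.
pose m := (Num.truncn (C / eta)).+1.
have hm : C / 2 ^+ m <= eta.
  rewrite ler_pdivrMr ?exprn_gt0// mulrC -ler_pdivrMr//.
  rewrite (le_trans (ltW (truncnS_gt _)))// -natrX ler_nat.
  by rewrite ltnW// ltn_expl.
have [d d_gt0 hd] := julia_shift_slow rf er eta0.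
pose e := Num.min d (d0 / 2).
have e0 : 0 < e by rewrite lt_min d_gt0 divr_gt0.
have ed : e <= d by rewrite ge_min lexx.
exists e; split=> //.
  by rewrite (@le_lt_trans _ _ (d0 / 2))// ?ge_min ?lexx ?orbT//; lra.
have near_m : \forall k \near \oo, `|lead_rate f k - lead_rate f m| <= eta.
  by near=> k; rewrite (le_trans (hC m k _))//; near: k; exact: nbhs_infty_ge.
have low := hd e e0 ed.
have esc := julia_shift_escapes er real e0.
have [muJ _] := eqmu.
set E := measure_mean mu _.
have mE : mean [set x : R | nonescaping f rho x%:C] E by exact: measure_mean_mean.
have EE : mean_pairing E E (logk e) <= lead_rate f m + eta.
  rewrite -lee_fin (le_trans (mean_pairing_le_log_energy cJ real muJ e0))//.
  apply: (equilibrium_energy_le rf er real nz0 eqmu).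
  by apply: filterS near_m => k; rewrite ler_norml => /andP[_]; lra.
near=> k; have [_ szk rsk pE] := hrs k.
have big x : nonescaping f rho x%:C -> rho + 1 <= cmod (Fcomp f k).[x +i* e].
  by move: x; near: k; exact: esc.
have lowk x z : nonescaping f rho x%:C -> nonescaping f rho z ->
    rho + 1 <= cmod (Fcomp f k).[x +i* e] ->
    ln (cmod ((Fcomp f k).[x +i* e] - (Fcomp f k).[z])) / (Fdeg f k)%:R <= eta.
  by move: x z; near: k; exact: low.
have rs0 : (0 < size (rs k))%N by rewrite szk Fdeg_gt0.
have mF := seq_mean_mean rs0 rsk.
have EF : lead_rate f k - eta <= mean_pairing E (seq_mean (rs k)) (logk e).
  rewrite -(mean_cst (lead_rate f k - eta) mE); have [_ mono _] := mE.
  apply: mono; [exact: cst_continuous|exact: mean_logk_continuous mF e0|].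
  move=> x nx; have [-> _] := avg_logk_le rf e0 nz0 szk pE (big _ nx).
  rewrite lerD2l lerN2; apply: (lowk x z0 nx nz0); exact: big.
have FE : lead_rate f k - eta <= mean_pairing (seq_mean (rs k)) E (logk e).
  by rewrite -(seq_mean_pairing_sym _ mE e0).
have FF : mean_pairing (seq_mean (rs k)) (seq_mean (rs k)) (logk e) <= lead_rate f k.
  rewrite -[leRHS](mean_cst (lead_rate f k) mF); have [_ mono _] := mF.
  apply: mono; [exact: mean_logk_continuous mF e0|exact: cst_continuous|].
  by move=> x nx; have [_] := avg_logk_le rf e0 nz0 szk pE (big _ nx).
have : `|lead_rate f k - lead_rate f m| <= eta by near: k; exact: near_m.
rewrite ler_norml /energy_gap => /andP[h1 h2].
by rewrite (_ : tau = 4 * eta); [lra|rewrite /eta; lra].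
Unshelve. all: by end_near. Qed.

(** * Resolvents *)

Definition seq_resolvent (R : realType) (s : seq R) (z : R[i]) : R[i] :=
  (size s)%:R^-1 * \sum_(r <- s) (r%:C - z)^-1.

Lemma Re_invc (R : realType) (z : R[i]) :
  complex.Re z^-1 = complex.Re z * (cmod z ^+ 2)^-1.
Proof. by rewrite sqr_cmod; case: z. Qed.

Lemma Im_invc (R : realType) (z : R[i]) :
  complex.Im z^-1 = - complex.Im z * (cmod z ^+ 2)^-1.
Proof. by rewrite sqr_cmod; case: z => a b /=; rewrite mulNr. Qed.

Lemma measurable_cauchy_kernel (R : realType) (z : R[i]) :
  measurable_fun [set: borelC R] (fun x : borelC R => complex.Re ((x : R[i]) - z)^-1)
  /\ measurable_fun [set: borelC R] (fun x : borelC R => complex.Im ((x : R[i]) - z)^-1).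
Proof.
(* Inversion on nonnegative reals in a visibly measurable form; the value 0 at 0 agrees with
   [0^-1 = 0]. *)
pose g (t : R) := if 0 < t then expR (- ln t) else 0.
have gE (w : R[i]) : (cmod w ^+ 2)^-1 = g (cmod w ^+ 2).
  rewrite /g; case: ifPn => [p|]; first by rewrite expRN lnK.
  by rewrite -leNgt => h; rewrite (le_anti (introT andP (conj h (sqr_ge0 _)))) invr0.
have mg : measurable_fun [set: R] g.
  apply: measurable_fun_ifT => //; first exact: measurable_fun_ltr.
  by apply: measurableT_comp => //; apply: measurableT_comp.
have mc : measurable_fun [set: borelC R]
    (fun x : borelC R => (cmod ((x : R[i]) - z) ^+ 2)^-1).
  rewrite (_ : (fun x : borelC R => _) = g \o (fun x : borelC R =>
    (complex.Re x - complex.Re z) ^+ 2 + (complex.Im x - complex.Im z) ^+ 2)).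
    apply: measurableT_comp => //; apply: measurable_funD.
      apply: (@measurable_funX _ _ _ setT (fun x : borelC R => complex.Re x - complex.Re z)).
      by apply: measurable_funB; [exact: measurable_Re|exact: measurable_cst].
    apply: (@measurable_funX _ _ _ setT (fun x : borelC R => complex.Im x - complex.Im z)).
    by apply: measurable_funB; [exact: measurable_Im|exact: measurable_cst].
  by apply/funext => x; rewrite gE sqr_cmod ReD ReN ImD ImN.
split.
  rewrite (_ : (fun x : borelC R => _) = (fun x : borelC R =>
     (complex.Re x - complex.Re z)) \* (fun x : borelC R => (cmod ((x : R[i]) - z) ^+ 2)^-1)).
    apply: measurable_funM => //.
    by apply: measurable_funB; [exact: measurable_Re|exact: measurable_cst].
  by apply/funext => x; rewrite /= Re_invc ReD ReN.
rewrite (_ : (fun x : borelC R => _) = (fun x : borelC R =>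
     (complex.Im z - complex.Im x)) \* (fun x : borelC R => (cmod ((x : R[i]) - z) ^+ 2)^-1)).
  apply: measurable_funM => //.
  by apply: measurable_funB; [exact: measurable_cst|exact: measurable_Im].
by apply/funext => x; rewrite /= Im_invc ImD ImN opprB.
Qed.

Lemma Rintegral_full (R : realType) (mu : probability (borelC R) R)
    (J : set (borelC R)) (g : borelC R -> R) :
  measurable J -> mu J = 1%E -> measurable_fun setT g ->
  Rintegral mu setT g = Rintegral mu J g.
Proof.
move=> mJ J1 mg; rewrite /Rintegral; congr fine; apply: integral_full => //.
exact/measurable_EFinP.
Qed.

Lemma Rintegral_close (R : realType) (mu : probability (borelC R) R)
    (J : set (borelC R)) (g h : borelC R -> R) (B delta : R) :
  measurable J -> mu J = 1%E -> measurable_fun setT g -> measurable_fun setT h ->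
  (forall x, J x -> `|g x| <= B) -> (forall x, J x -> `|h x| <= B) ->
  (forall x, J x -> `|g x - h x| <= delta) ->
  `|Rintegral mu setT g - Rintegral mu setT h| <= delta.
Proof.
move=> mJ J1 mg mh gB hB gh; rewrite !(Rintegral_full mJ J1)//.
have Jfin : (mu J < +oo)%E by rewrite (le_lt_trans (probability_le1 mu mJ))// ltry.
have int (u : borelC R -> R) (A : R) : measurable_fun setT u ->
    (forall x, J x -> `|u x| <= A) -> mu.-integrable J (EFin \o u).
  by move=> mu' uA; apply: (@bounded_integrable _ _ _ _ _ _ A) => //; exact: measurable_funTS.
have icst : mu.-integrable J (EFin \o (fun _ : borelC R => delta)).
  by apply: (int _ `|delta|) => //; exact: measurable_cst.
have le (u v : borelC R -> R) : mu.-integrable J (EFin \o u) ->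
    mu.-integrable J (EFin \o v) -> (forall x, J x -> u x <= v x + delta) ->
    Rintegral mu J u <= Rintegral mu J v + delta.
  move=> iu iv uv.
  have -> : Rintegral mu J v + delta = Rintegral mu J (fun x => v x + delta).
    by rewrite RintegralD// Rintegral_cst//; move: J1 => /= ->; rewrite mulr1.
  apply: le_Rintegral => //.
  exact: (integrableD mJ iv icst).
have ig := int _ _ mg gB; have ih := int _ _ mh hB.
have h1 : Rintegral mu J g <= Rintegral mu J h + delta.
  by apply: le => // x /gh; rewrite ler_norml => /andP[_]; lra.
have h2 : Rintegral mu J h <= Rintegral mu J g + delta.
  by apply: le => // x /gh; rewrite ler_norml => /andP[]; lra.
by rewrite ler_norml; apply/andP; split; lra.
Qed.

(** The real and imaginary parts are estimated separately, whence the factor 2. *)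
Lemma complex_integral_close (R : realType) (mu : probability (borelC R) R)
    (J : set (borelC R)) (g h : R[i] -> R[i]) (B delta : R) :
  measurable J -> mu J = 1%E ->
  measurable_fun [set: borelC R] (fun x : borelC R => complex.Re (g x)) ->
  measurable_fun [set: borelC R] (fun x : borelC R => complex.Im (g x)) ->
  measurable_fun [set: borelC R] (fun x : borelC R => complex.Re (h x)) ->
  measurable_fun [set: borelC R] (fun x : borelC R => complex.Im (h x)) ->
  (forall x, J x -> cmod (g x) <= B) -> (forall x, J x -> cmod (h x) <= B) ->
  (forall x, J x -> cmod (g x - h x) <= delta) ->
  cmod (complex_integral mu g - complex_integral mu h) <= 2 * delta.
Proof.
move=> mJ J1 rg ig rh ih gB hB gh.
rewrite (le_trans (cmod_le_ReIm _))// mulr2n mulrDl mul1r lerD//.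
  rewrite ReD ReN /=; apply: (Rintegral_close mJ J1 rg rh).
  - by move=> x /gB; apply: le_trans; exact: Re_le_cmod.
  - by move=> x /hB; apply: le_trans; exact: Re_le_cmod.
  - by move=> x /gh; apply: le_trans; rewrite -ReN -ReD Re_le_cmod.
rewrite ImD ImN /=; apply: (Rintegral_close mJ J1 ig ih).
- by move=> x /gB; apply: le_trans; exact: Im_le_cmod.
- by move=> x /hB; apply: le_trans; exact: Im_le_cmod.
- by move=> x /gh; apply: le_trans; rewrite -ImN -ImD Im_le_cmod.
Qed.

Lemma inv_diff_le (R : realType) (x z w : R[i]) (eta : R) : 0 < eta ->
  eta <= cmod (x - z) -> eta <= cmod (x - w) ->
  cmod ((x - z)^-1 - (x - w)^-1) <= cmod (z - w) / eta ^+ 2.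
Proof.
move=> eta0 hz hw.
have z0 : x - z != 0 by rewrite -cmod_gt0 (lt_le_trans eta0).
have w0 : x - w != 0 by rewrite -cmod_gt0 (lt_le_trans eta0).
have -> : (x - z)^-1 - (x - w)^-1 = (z - w) * ((x - z)^-1 * (x - w)^-1).
  by field; rewrite z0 w0.
rewrite cmodM ler_wpM2l ?cmod_ge0// cmodM !cmodV expr2 invfM.
by rewrite ler_pM ?invr_ge0 ?cmod_ge0// lef_pV2 ?posrE ?cmod_gt0.
Qed.

Lemma resolvent_lipschitz (R : realType) (mu : probability (borelC R) R)
    (J : set (borelC R)) (z w : R[i]) (eta : R) :
  measurable J -> mu J = 1%E -> 0 < eta ->
  (forall x : R[i], J x -> eta <= cmod (x - z)) ->
  (forall x : R[i], J x -> eta <= cmod (x - w)) ->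
  cmod (resolvent mu z - resolvent mu w) <= 2 * (cmod (z - w) / eta ^+ 2).
Proof.
move=> mJ J1 eta0 hz hw.
have [rz iz] := measurable_cauchy_kernel z; have [rw iw] := measurable_cauchy_kernel w.
have bd (v x : R[i]) : eta <= cmod (x - v) -> cmod (x - v)^-1 <= eta^-1.
  by move=> h; rewrite cmodV lef_pV2 ?posrE// (lt_le_trans eta0).
apply: (complex_integral_close mJ J1 rz iz rw iw) => x Jx.
- exact: bd (hz _ Jx).
- exact: bd (hw _ Jx).
- exact: inv_diff_le eta0 (hz _ Jx) (hw _ Jx).
Qed.

Lemma seq_resolvent_lipschitz (R : realType) (s : seq R) (z w : R[i]) (eta : R) :
  (0 < size s)%N -> 0 < eta ->
  (forall x, x \in s -> eta <= cmod (x%:C - z)) ->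
  (forall x, x \in s -> eta <= cmod (x%:C - w)) ->
  cmod (seq_resolvent s z - seq_resolvent s w) <= cmod (z - w) / eta ^+ 2.
Proof.
move=> s0 eta0 hz hw; have sR : 0 < (size s)%:R :> R by rewrite ltr0n.
rewrite /seq_resolvent -mulrBr -sumrB cmodM cmodV cmod_nat ler_pdivrMl//.
rewrite (le_trans (cmod_sum _ _ _))// big_seq.
apply: (@le_trans _ _ (\sum_(x <- s | x \in s) cmod (z - w) / eta ^+ 2)).
  by apply: ler_sum => x xs; apply: inv_diff_le => //; [exact: hz|exact: hw].
by rewrite -big_seq big_const_seq count_predT iter_addr_0 mulr_natl.
Qed.

Lemma seq_resolvent_le (R : realType) (s : seq R) (z : R[i]) (eta : R) :
  (0 < size s)%N -> 0 < eta ->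
  (forall x, x \in s -> eta <= cmod (x%:C - z)) ->
  cmod (seq_resolvent s z) <= eta^-1.
Proof.
move=> s0 eta0 hz; have sR : 0 < (size s)%:R :> R by rewrite ltr0n.
rewrite /seq_resolvent cmodM cmodV cmod_nat ler_pdivrMl//.
rewrite (le_trans (cmod_sum _ _ _))// big_seq.
apply: (@le_trans _ _ (\sum_(x <- s | x \in s) eta^-1)).
  apply: ler_sum => x xs; rewrite cmodV lef_pV2 ?posrE ?hz//.
  exact: lt_le_trans (hz _ xs).
by rewrite -big_seq big_const_seq count_predT iter_addr_0 mulr_natl.
Qed.

(** As [mu] has mass 1, [- 1/w] is its own integral. The integrands differ by [x / ((x - w) w)], at
    most [2 rho / |w|^2] because [|x - w| >= |w| / 2]. *)
Lemma resolvent_at_infinity (R : realType) (mu : probability (borelC R) R)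
    (J : set (borelC R)) (w : R[i]) (rho : R) :
  measurable J -> mu J = 1%E -> 0 < rho -> 2 * rho <= cmod w ->
  (forall x : R[i], J x -> cmod x <= rho) ->
  cmod (resolvent mu w + w^-1) <= 4 * rho / cmod w ^+ 2.
Proof.
move=> mJ J1 rho0 hw Jrho.
have w0 : 0 < cmod w by lra.
have wn0 : w != 0 by rewrite -cmod_gt0.
have far x : J x -> cmod w / 2 <= cmod ((x : R[i]) - w).
  move=> /Jrho xr; rewrite cmodB (le_trans _ (cmodD_ge _ _))// cmodN; lra.
have [rw iw] := measurable_cauchy_kernel w.
have rc : measurable_fun [set: borelC R] (fun x : borelC R => complex.Re (- w^-1)).
  exact: measurable_cst.
have ic : measurable_fun [set: borelC R] (fun x : borelC R => complex.Im (- w^-1)).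
  exact: measurable_cst.
have cE : complex_integral mu (fun=> - w^-1) = - w^-1.
  rewrite /complex_integral !Rintegral_cst//.
  have := @probability_setT _ _ _ mu => /= ->.
  by rewrite !mulr1; case: (- w^-1).
have -> : resolvent mu w + w^-1 = resolvent mu w - complex_integral mu (fun=> - w^-1).
  by rewrite cE opprK.
rewrite (_ : 4 * rho / cmod w ^+ 2 = 2 * (2 * rho / cmod w ^+ 2)); last by ring.
apply: (complex_integral_close (B := 2 / cmod w) mJ J1 rw iw rc ic) => x Jx.
- rewrite cmodV -(invrK 2) -invfM lef_pV2 ?posrE ?mulr_gt0 ?invr_gt0//.
    by rewrite mulrC far.
  by rewrite (lt_le_trans _ (far _ Jx))// divr_gt0.
- by rewrite cmodN cmodV -[leLHS]mul1r ler_wpM2r ?invr_ge0 ?cmod_ge0// ler1n.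
have xw : (x : R[i]) - w != 0.
  by rewrite -cmod_gt0 (lt_le_trans _ (far _ Jx))// divr_gt0.
have -> : ((x : R[i]) - w)^-1 - - w^-1 = (x : R[i]) * (((x : R[i]) - w)^-1 * w^-1).
  by field; rewrite wn0 xw.
rewrite cmodM mulrC (_ : 2 * rho / cmod w ^+ 2 = (2 / cmod w * (cmod w)^-1) * rho); last first.
  by field; rewrite gt_eqF.
rewrite ler_pM ?cmod_ge0 ?Jrho// cmodM !cmodV ler_wpM2r ?invr_ge0 ?cmod_ge0//.
rewrite -(invrK 2) -invfM lef_pV2 ?posrE ?mulr_gt0 ?invr_gt0//.
  by rewrite mulrC far.
by rewrite (lt_le_trans _ (far _ Jx))// divr_gt0.
Qed.

(** [log_energy_ge] concerns the upper half-plane. For real measures, reflecting [z] only changes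
    the sign of the imaginary part of the resolvent; this sign [sg] disappears on squaring. *)
Lemma resolvent_gap (R : realType) (mu : probability (borelC R) R)
    (J : set R[i]) (s : seq R) (z : R[i]) (e : R) :
  compact J -> (forall x, J x -> complex.Im x = 0) ->
  mu (J : set (borelC R)) = 1%E ->
  (0 < size s)%N -> (forall x, x \in s -> J x%:C) ->
  0 < e -> e < `|complex.Im z| ->
  (2 * `|complex.Im z| - e) ^+ 2 * cmod (resolvent mu z - seq_resolvent s z) ^+ 2
  <= energy_gap (measure_mean mu J) (seq_mean s) e.
Proof.
move=> cJ rJ J1 s0 sJ e0 eb.
have mJ := measurable_compact_complex cJ.
have mE := measure_mean_mean cJ rJ J1.
have mF := @seq_mean_mean R [set x : R | J x%:C] s s0 sJ.
set a := complex.Re z; set b := `|complex.Im z| in eb *.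
have b0 : 0 < b by exact: lt_trans eb.
have b2 : complex.Im z ^+ 2 = b ^+ 2 by rewrite real_normK// num_real.
pose sg := complex.Im z / b.
have sg2 : sg ^+ 2 = 1 by rewrite /sg exprMn b2 exprVn divff// expf_neq0// gt_eqF.
have sgE : complex.Im z = sg * b by rewrite /sg mulfVK// gt_eqF.
have reE (x : R[i]) : complex.Im x = 0 ->
    complex.Re (x - z)^-1 = cauchy_re a b (complex.Re x).
  by move=> x0; rewrite Re_invc sqr_cmod ReD ReN ImD ImN x0 sub0r sqrrN b2.
have imE (x : R[i]) : complex.Im x = 0 ->
    complex.Im (x - z)^-1 = sg * cauchy_im a b (complex.Re x).
  move=> x0; rewrite Im_invc sqr_cmod ReD ReN ImD ImN x0 sub0r sqrrN b2 opprK sgE.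
  by rewrite /cauchy_im mulrA.
have [mr mi] := measurable_cauchy_kernel z.
have [cre cim] := continuous_cauchy a b0.
have Rmu : complex.Re (resolvent mu z) = measure_mean mu J (cauchy_re a b).
  rewrite /= (Rintegral_full mJ J1 mr); apply: eq_Rintegral => x.
  by rewrite inE => /rJ; exact: reE.
have Imu : complex.Im (resolvent mu z) = sg * measure_mean mu J (cauchy_im a b).
  rewrite /= (Rintegral_full mJ J1 mi) -(meanZ _ mE cim).
  by apply: eq_Rintegral => x; rewrite inE => /rJ; exact: imE.
have natC n : (n%:R : R[i])^-1 = (n%:R^-1)%:C by rewrite -[RHS]/(real_complex R _) fmorphV rmorph_nat.
have Rs : complex.Re (seq_resolvent s z) = seq_mean s (cauchy_re a b).
  rewrite /seq_resolvent natC Re_real_scale Re_sum; congr (_ * _).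
  by apply: eq_bigr => r _; exact: (reE r%:C erefl).
have Im_real_scale (t : R) (w : R[i]) : complex.Im (t%:C * w) = t * complex.Im w.
  by case: w => u v /=; rewrite mul0r addr0.
have Im_sum (F : R -> R[i]) :
    complex.Im (\sum_(r <- s) F r) = \sum_(r <- s) complex.Im (F r).
  by elim/big_ind2: _ => [|x u y v <- <-|//]; rewrite ?ImD.
have Is : complex.Im (seq_resolvent s z) = sg * seq_mean s (cauchy_im a b).
  rewrite /seq_resolvent natC Im_real_scale Im_sum /seq_mean mulrCA; congr (_ * _).
  by rewrite mulr_sumr; apply: eq_bigr => r _; exact: (imE r%:C erefl).
have hM : exists M : R, forall x, J x%:C -> (x - a) ^+ 2 + b ^+ 2 <= M.
  have [M M0 hM] := compact_cmod_bounded cJ.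
  exists ((M + `|a|) ^+ 2 + b ^+ 2) => x /hM; rewrite cmod_real => xM.
  rewrite lerD2r -(real_normK (num_real (x - a))) lerXn2r ?nnegrE ?addr_ge0 ?(ltW M0)//.
  by rewrite (le_trans (ler_normB _ _))// lerD2r.
have [M {}hM] := hM.
have := log_energy_ge mE mF e0 eb hM (mean_logk_continuous mE e0) (mean_logk_continuous mF e0).
rewrite sqr_cmod ReD ReN ImD ImN Rmu Imu Rs Is -mulrBr.
by rewrite [(sg * _) ^+ 2]exprMn sg2 mul1r.
Qed.

Lemma compact_separated (R : realType) (K J : set R[i]) :
  compact K -> closed J -> K `<=` ~` J ->
  exists2 eta : R, 0 < eta & forall z x, K z -> J x -> eta <= cmod (x - z).
Proof.
move=> /compact_near_coveringP cK clJ KJ.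
have [] := cK nat \oo (fun n z => forall x, J x -> n.+1%:R^-1 <= cmod (x - z)) _.
  move=> z /KJ nJz.
  have /open_cmodP/(_ z nJz)[e e0 he] := closed_openC clJ.
  pose N := Num.truncn (2 / e).
  exists ([set w | cmod (w - z) < e / 2], [set n | (N <= n)%N]) => /=.
    split; first by apply/nbhs_cmodP; exists (e / 2) => //; rewrite divr_gt0.
    by exists N.
  move=> [w n] /= [wz Nn] x Jx.
  have xz : e <= cmod (x - z) by rewrite leNgt; apply/negP => /he; exact.
  have : 2 / e < n.+1%:R.
    by rewrite (lt_le_trans (truncnS_gt _))// ler_nat ltnS.
  rewrite ltr_pdivrMr// => ne.
  rewrite (@le_trans _ _ (e / 2))//.
    by rewrite invf_ple ?posrE ?divr_gt0// invf_div ler_pdivrMr//; exact: ltW.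
  have := cmodD (x - w) (w - z); rewrite addrA subrK; lra.
move=> N _ hN; exists N.+1%:R^-1; first by rewrite invr_gt0.
by move=> z x Kz Jx; exact: (hN N (leqnn N) z Kz x Jx).
Qed.

Lemma seq_resolvent_cvg (R : realType) (f : nat -> {poly R[i]}) (rho : R)
    (mu : probability (borelC R) R) z0 (rs : nat -> seq R) (K : set R[i]) (eps : R) :
  regular_polynomial_sequence f -> escape_radius f rho ->
  (forall z, nonescaping f rho z -> complex.Im z = 0) ->
  nonescaping f rho z0 ->
  is_equilibrium_measure (nonescaping f rho) mu ->
  (forall k, [/\ sorted <=%R (rs k), size (rs k) = Fdeg f k,
    forall r, r \in rs k -> nonescaping f rho r%:C &
    Fcomp f k - (Fcomp f k).[z0]%:P =
      lead_coef (Fcomp f k) *: \prod_(r <- rs k) ('X - r%:C%:P)]) ->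
  compact K -> K `<=` ~` nonescaping f rho -> 0 < eps ->
  \forall k \near \oo, forall z, K z ->
    cmod (resolvent mu z - seq_resolvent (rs k) z) <= eps.
Proof.
move=> rf er real nz0 eqmu hrs cK KJ eps0.
have cJ := @nonescaping_compact R f rho.
have clJ : closed (nonescaping f rho).
  by apply: compact_closed => //; exact: complex_hausdorff.
have mJ := measurable_compact_complex cJ.
have [muJ _] := eqmu.
have [eta' eta'0 heta'] := compact_separated cK clJ KJ.
pose eta := eta' / 2; have eta0 : 0 < eta by rewrite divr_gt0.
(* A vertical step of length [d <= eta] keeps the point at distance [eta] from [J]. The Lipschitz
   errors [2 d / eta^2] and [d / eta^2] then add up to at most [eps / 2]. *)
pose d := Num.min eta (eps * eta ^+ 2 / 6).
have d0 : 0 < d by rewrite lt_min eta0 divr_gt0 ?mulr_gt0 ?exprn_gt0.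
have deta : d <= eta by rewrite ge_min lexx.
have dsmall : d / eta ^+ 2 <= eps / 6.
  rewrite ler_pdivrMr ?exprn_gt0// mulrAC.
  by rewrite ge_min lexx orbT.
(* With [|Im w| >= d] and [e < d], the factor [2 |Im w| - e] in [resolvent_gap] is at least [d].
   This gap therefore gives an error of at most [eps / 2], with the same [e] and threshold for all
   points of [K]. *)
have tau0 : 0 < (d * (eps / 2)) ^+ 2 by rewrite exprn_gt0// mulr_gt0// divr_gt0.
have [e [e0 ed gap]] := energy_gap_small rf er real nz0 eqmu hrs tau0 d0.
near=> k => z Kz; have [_ szk rsk _] := hrs k.
have s0 : (0 < size (rs k))%N by rewrite szk Fdeg_gt0.
(* Step off the real axis, where the energy gap controls the resolvents. *)
pose w : R[i] := z + (0 +i* (if 0 <= complex.Im z then d else - d)).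
have zw : cmod (z - w) = d.
  rewrite /w opprD addrA subrr sub0r cmodN cmodE/= expr0n add0r sqrtr_sqr.
  by case: ifP => _; rewrite ?normrN ger0_norm// ltW.
have Imw : d <= `|complex.Im w|.
  rewrite /w ImD /=; case: ifPn => [h|]; first by rewrite ger0_norm; lra.
  by rewrite -ltNge => h; rewrite ltr0_norm; lra.
have hz x : nonescaping f rho x -> eta <= cmod (x - z).
  by move=> Jx; have := heta' _ _ Kz Jx; rewrite /eta; lra.
have hw x : nonescaping f rho x -> eta <= cmod (x - w).
  move=> Jx; have := heta' _ _ Kz Jx.
  have := cmodD (x - w) (w - z); rewrite addrA subrK (cmodB w z) zw.
  by move: deta; rewrite /eta; lra.
have h1 := resolvent_lipschitz mJ muJ eta0 hz hw.
have h2 := seq_resolvent_lipschitz s0 eta0 (fun x xs => hz _ (rsk x xs))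
  (fun x xs => hw _ (rsk x xs)).
have eb : e < `|complex.Im w| by exact: lt_le_trans Imw.
have h3 : cmod (resolvent mu w - seq_resolvent (rs k) w) <= eps / 2.
  have := resolvent_gap cJ real muJ s0 rsk e0 eb.
  have : energy_gap (measure_mean mu (nonescaping f rho)) (seq_mean (rs k)) e
     <= (d * (eps / 2)) ^+ 2 by near: k; exact: gap.
  set c := cmod _; move=> g1 g2.
  have c0 : 0 <= c by exact: cmod_ge0.
  have : (d * c) ^+ 2 <= (d * (eps / 2)) ^+ 2.
    rewrite (le_trans _ g1)// (le_trans _ g2)// exprMn ler_wpM2r ?sqr_ge0//.
    by rewrite lerXn2r ?nnegrE ?(ltW d0)//; lra.
  rewrite ler_sqr ?nnegrE ?mulr_ge0 ?(ltW d0) ?(ltW eps0)//.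
  by rewrite ler_pM2l.
rewrite zw in h1 h2.
have -> : resolvent mu z - seq_resolvent (rs k) z =
   (resolvent mu z - resolvent mu w) + (resolvent mu w - seq_resolvent (rs k) w)
   - (seq_resolvent (rs k) z - seq_resolvent (rs k) w) by ring.
rewrite (le_trans (cmodD _ _))// cmodN.
have := cmodD (resolvent mu z - resolvent mu w)
  (resolvent mu w - seq_resolvent (rs k) w).
by lra.
Unshelve. all: by end_near. Qed.

(* [F_k' / (d_1...d_k) = - (F_k - F_k z0) S_k] with [S_k] the resolvent of the
   roots, while [w R(w) -> -1] at infinity. *)
Lemma pulled_back_resolvent (R : realType) (f : nat -> {poly R[i]}) (rho : R)
    (mu : probability (borelC R) R) z0 (rs : seq R) k (z : R[i]) (eta : R) :
  regular_polynomial_sequence f -> escape_radius f rho ->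
  nonescaping f rho z0 ->
  mu (nonescaping f rho : set (borelC R)) = 1%E ->
  size rs = Fdeg f k -> (forall r, r \in rs -> nonescaping f rho r%:C) ->
  Fcomp f k - (Fcomp f k).[z0]%:P =
      lead_coef (Fcomp f k) *: \prod_(r <- rs) ('X - r%:C%:P) ->
  0 < eta -> (forall x, nonescaping f rho x -> eta <= cmod (x - z)) ->
  2 * rho <= cmod (Fcomp f k).[z] ->
  cmod (resolvent mu (Fcomp f k).[z] * (Fcomp f k)^`().[z] / (Fdeg f k)%:R
        - seq_resolvent rs z) <= 9 * rho / (eta * cmod (Fcomp f k).[z]).
Proof.
move=> rf er nz muJ szrs rsJ pE eta0 hz big.
have rho0 : 0 < rho by case: er => h _; rewrite (lt_le_trans _ h).
have mJ := measurable_compact_complex (@nonescaping_compact R f rho).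
set w := (Fcomp f k).[z] in big *; set a := (Fcomp f k).[z0] in pE.
have ar : cmod a <= rho by exact: nz.
have w0 : 0 < cmod w by lra.
have wn0 : w != 0 by rewrite -cmod_gt0.
have wa : w - a != 0.
  rewrite -cmod_gt0 (lt_le_trans _ (cmodD_ge _ _))// cmodN; lra.
have s0 : (0 < size rs)%N by rewrite szrs Fdeg_gt0.
have Dn0 : (Fdeg f k)%:R != 0 :> R[i] by rewrite pnatr_eq0 -lt0n Fdeg_gt0.
set Q := resolvent mu w.
have hQ := resolvent_at_infinity mJ muJ rho0 big (fun x (Jx : nonescaping f rho x) =>
   (ltac:(by have := Jx 0%N; rewrite /= hornerX) : cmod x <= rho)).
have logd : (Fcomp f k)^`().[z] = - (w - a) * ((Fdeg f k)%:R * seq_resolvent rs z).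
  have pz : (lead_coef (Fcomp f k) *: \prod_(r <- rs) ('X - r%:C%:P)).[z] != 0.
    by rewrite -pE !hornerE.
  have := deriv_div_roots pz; rewrite -pE derivB derivC subr0.
  rewrite hornerD hornerN hornerC -/w => h.
  have -> : (Fcomp f k)^`().[z] = (w - a) * ((Fcomp f k)^`().[z] / (w - a)).
    by rewrite mulrC mulfVK.
  rewrite h mulNr -mulrN; congr (_ * _).
  rewrite /seq_resolvent szrs mulrA divff// mul1r -sumrN; apply: eq_bigr => r _.
  by rewrite -invrN opprB.
(* The bracket is [Q (w - a) + 1], rearranged to isolate the small quantity [Q + 1/w]. Its two terms
   are at most [8 rho / |w|] and [rho / |w|], whence the 9. *)
have -> : Q * (Fcomp f k)^`().[z] / (Fdeg f k)%:R - seq_resolvent rs z =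
   - (((Q + w^-1) * (w - a) + a / w) * seq_resolvent rs z).
  by rewrite logd; field; rewrite wn0 Dn0.
have hS := seq_resolvent_le s0 eta0 (fun x xs => hz _ (rsJ x xs)).
rewrite cmodN cmodM invfM mulrA (mulrAC _ eta^-1) ler_pM ?cmod_ge0//.
rewrite (le_trans (cmodD _ _))// !cmodM cmodV.
have wa2 : cmod (w - a) <= 2 * cmod w.
  by rewrite (le_trans (cmodD _ _))// cmodN; lra.
have h1 := ler_pM (cmod_ge0 _) (cmod_ge0 _) hQ wa2.
have h2 : cmod a / cmod w <= rho / cmod w by rewrite ler_wpM2r ?invr_ge0 ?cmod_ge0.
rewrite (le_trans (lerD h1 h2))// le_eqVlt; apply/orP; left; apply/eqP.
by field; rewrite gt_eqF.
Qed.

Theorem theorem4p2 (R : realType) (f : nat -> {poly R[i]})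
    (mu : probability (borelC R) R) :
  regular_polynomial_sequence f ->
  julia_set f `<=` @sphere_real_line R ->
  is_equilibrium_measure (planar_part (julia_set f)) mu ->
  forall K : set R[i], compact K -> K `<=` ~` planar_part (julia_set f) ->
    (\forall k \near \oo, forall z, K z ->
       ~ planar_part (julia_set f) (Fcomp f k).[z]) /\
    {uniform K,
      (fun (k : nat) (z : R[i]) =>
         resolvent mu (Fcomp f k).[z] * (Fcomp f k)^`().[z]
           / (\prod_(1 <= i < k.+1) deg (f i))%N%:R) @ \oo
      --> resolvent mu}.
Proof.
move=> rf Jr; have [rho rho1 esc] := regular_escape rf.
have er : escape_radius f rho by split.
rewrite (planar_julia er Jr) => eqmu K cK KJ.
have real z : nonescaping f rho z -> complex.Im z = 0.
  by rewrite -(planar_julia er Jr) => /Jr [x _ [<-]].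
have rho0 : 0 < rho by exact: lt_le_trans rho1.
have [m hm] := escaping_compact er cK KJ.
have large M : \forall k \near \oo, forall z, K z -> M <= cmod (Fcomp f k).[z].
  by apply: filterS (escape_large m er M) => k hk z /hm; exact: hk.
split.
  apply: filterS (large (rho + 1)) => k hk z Kz /(_ 0%N); rewrite /= hornerX.
  by have := hk z Kz; lra.
have [muJ _] := eqmu.
(* The base point of the fibres exists because [mu] gives [J] mass 1. *)
have [z0 nz0] : exists z0, nonescaping f rho z0.
  apply: contrapT => J0; move: muJ.
  have -> : nonescaping f rho = set0.
    by apply/seteqP; split=> // z nz; apply: J0; exists z.
  by rewrite measure0 => /eqP; rewrite eqe eq_sym oner_eq0.
have /choice[rs hrs] := fun k => preimage_list k rf er real nz0.
have clJ : closed (nonescaping f rho).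
  by apply: compact_closed; [exact: complex_hausdorff|exact: nonescaping_compact].
have [eta eta0 heta] := compact_separated cK clJ KJ.
move=> P /uniform_nbhs[A [+ AP]]; rewrite -entourage_ballE => -[e e0 eA].
have [eps eps0 epsA] : exists2 eps : R, 0 < eps &
    forall x y : R[i], cmod (x - y) < eps -> A (x, y).
  have /andP[/eqP ei er'] : (complex.Im e == 0) && (0 < complex.Re e).
    by move: e0; rewrite /= ltcE /= eq_sym.
  exists (complex.Re e) => // x y xy; apply: eA; rewrite /ball/= norm_cmod.
  by case: (e) ei xy => u v /= -> ?; rewrite ltcR.
have eps4 : 0 < eps / 4 by rewrite divr_gt0.
suff : \forall k \near \oo, forall z, K z ->
    A (resolvent mu z, resolvent mu (Fcomp f k).[z] * (Fcomp f k)^`().[z]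
         / (Fdeg f k)%:R).
  by apply: filterS => k hk; exact: AP.
near=> k => z Kz; apply: epsA.
have [_ szk rsk pE] := hrs k.
have h1 : cmod (resolvent mu z - seq_resolvent (rs k) z) <= eps / 4.
  move: z Kz; near: k.
  exact: seq_resolvent_cvg rf er real nz0 eqmu hrs cK KJ eps4.
have big : 2 * rho <= cmod (Fcomp f k).[z].
  by move: z Kz {h1}; near: k; exact: large.
(* Chosen so that the error [9 rho / (eta |F_k(z)|)] of [pulled_back_resolvent] is at most
   [eps / 4]. *)
have big2 : 36 * rho / (eta * eps) <= cmod (Fcomp f k).[z].
  by move: z Kz {h1 big}; near: k; exact: large.
have := pulled_back_resolvent rf er nz0 muJ szk rsk pE eta0
  (fun x Jx => heta z x Kz Jx) big.
set T := _ * _ / _; set w := cmod _.[z] in big big2 * => h2.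
have h3 : 9 * rho / (eta * w) <= eps / 4.
  have w0 : 0 < w by lra.
  rewrite ler_pdivrMr ?mulr_gt0//.
  by move: big2; rewrite ler_pdivrMr ?mulr_gt0//; lra.
have -> : resolvent mu z - T =
  (resolvent mu z - seq_resolvent (rs k) z) - (T - seq_resolvent (rs k) z) by ring.
rewrite (le_lt_trans (cmodD _ _))// cmodN; lra.
Unshelve. all: by end_near. Qed.
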